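(* Let $(\Omega_0,\Sigma_0)$ be a standard Borel space and let $\xi\equiv(\xi_n)_{n\in\mathbb{N}_0}$ be a sequence of $(\Omega_0,\Sigma_0)$-valued random variables on the standard probability space $(\Omega,\Sigma,\mu)$. Then the following are equivalent: (a) $\xi$ is maximal partially spreadable; (b) $\xi$ is a stationary Markov sequence.
   Context: All $\sigma$-subalgebras are completed with respect to $\mu$-null sets. For $I\subset\mathbb{N}_0$, $\Sigma^\xi_I$ denotes the $\sigma$-subalgebra of $\Sigma$ generated by $\{\xi_i: i\in I\}$; $\sigma\{\xi_n\}:=\Sigma^\xi_{\{n\}}$. For a $\sigma$-subalgebra $\tilde\Sigma\subset\Sigma$, $\mathbb{E}_{\tilde\Sigma}$ is the $\mu$-preserving conditional expectation from $L^\infty(\Omega,\Sigma,\mu)$ onto $L^\infty(\Omega,\tilde\Sigma,\mu|_{\tilde\Sigma})$. Stationary: $(\xi_0,\xi_1,\xi_2,\dots)$ and $(\xi_n,\xi_{n+1},\xi_{n+2},\dots)$ have the same distribution for all $n\ge 1$. Markov sequence: $\mathbb{E}_{\Sigma^\xi_{[0,n]}}\mathbb{E}_{\sigma\{\xi_{n+1}\}}=\mathbb{E}_{\sigma\{\xi_n\}}\mathbb{E}_{\sigma\{\xi_{n+1}\}}$ for all $n\ge 0$, where $[0,n]=\{0,1,\dots,n\}$. Partially spreadable: there exist $\Sigma$-measurable $\mu$-preserving maps $\{\eta_n\}_{n\ge 0}$ on $\Omega$ satisfying $\eta_\ell\circ\eta_k=\eta_k\circ\eta_{\ell+1}$ for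 all $0\le k<\ell<\infty$ (so that the operators $\alpha_n(f):=f\circ\eta_n$ satisfy the relations $\alpha_k\alpha_\ell=\alpha_{\ell+1}\alpha_k$ of the Thompson monoid $F^+$ for $k<\ell$), such that $\xi_0=\xi_0\circ\eta_k$ for all $k>0$ (localization) and $\xi_n=\xi_0\circ\eta_0^n$ for all $n\ge 0$ (stationarity). Maximal partially spreadable: there exist $\Sigma$-measurable $\mu$-preserving maps $\{\eta_n\}_{n\ge0}$ on $\Omega$ satisfying $\eta_\ell\circ\eta_k=\eta_k\circ\eta_{\ell+1}$ for all $0\le k<\ell<\infty$, such that $\xi_0=\xi_0\circ\eta_k$ for all $k>0$ and $\xi_n=\xi_0\circ\eta_0^n$ for all $n\ge 0$, and which satisfy in addition $\sigma\{\xi_0\}=\bigcap_{k\ge 1}\mathcal{I}_{\eta_k}$, where $\mathcal{I}_{\eta_k}$ is the $\sigma$-subalgebra of $\mu$-almost $\eta_k$-invariant sets in $\Sigma$. More generally, a sequence of $(\Omega_0,\Sigma_0)$-valued random variables on a probability space is called partially spreadable if it has the same distribution as a sequence $(\xi'_n)_{n\ge 0}$ of $(\Omega_0,\Sigma_0)$-valued random variables on some (possibly different) standard probability space $(\Omega',\Sigma',\mu')$ for which there exist $\Sigma'$-measurable $\mu'$-preserving maps $\{\eta'_n\}_{n\ge 0}$ on $\Omega'$ with $\eta'_\ell\circ\eta'_k=\eta'_k\circ\eta'_{\ell+1}$ for all $0\le k<\ell<\infty$, $\xi'_0=\xi'_0\circ\eta'_k$ for all $k>0$ and $\xi'_n=\xi'_0\circ(\eta'_0)^n$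 for all $n\ge 0$; it is called maximal partially spreadable if these can be chosen such that in addition $\sigma\{\xi'_0\}=\bigcap_{k\ge 1}\mathcal{I}_{\eta'_k}$, where $\mathcal{I}_{\eta'_k}$ is the $\sigma$-subalgebra of $\mu'$-almost $\eta'_k$-invariant sets in $\Sigma'$. *)

(* Defs.v *)
From HB Require Import structures.
From mathcomp Require Import all_boot all_order all_algebra.
From mathcomp Require Import all_classical all_reals all_analysis.

Set Implicit Arguments.
Unset Strict Implicit.
Unset Printing Implicit Defensive.

Import Order.TTheory GRing.Theory Num.Theory.
Import numFieldNormedType.Exports.

Local Open Scope classical_set_scope.
Local Open Scope ring_scope.

(* A Polish space is rendered as a separable Hausdorff complete pseudometric
   space: a Hausdorff pseudometric is a metric. The set equation reads: the
   bijection [f] identifies the measurable sets of [T] with the Borel sets of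
   [P]. *)
Definition standard_borel (R : realType) (d : measure_display)
    (T : measurableType d) : Prop :=
  exists (P : completePseudoMetricType R) (f : T -> P),
    [/\ hausdorff_space P,
        exists2 D : set P, countable D & dense D,
        bijective f &
        forall A : set T, measurable A <-> <<s @open P >> (f @` A)].

Definition cylinder_sigma (d : measure_display) (T : measurableType d) :
    set (set (nat -> T)) :=
  <<s \bigcup_(n in [set: nat])
        preimage_set_system setT (fun x : nat -> T => x n) measurable >>.

Definition same_law (R : realType) (d d1 d2 : measure_display)
    (T : measurableType d) (Omega1 : measurableType d1)
    (Omega2 : measurableType d2)
    (P1 : probability Omega1 R) (X1 : nat -> {RV P1 >-> T})
    (P2 : probability Omega2 R) (X2 : nat -> {RV P2 >-> T}) : Prop :=
  forall A : set (nat -> T), cylinder_sigma A ->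
    P1 [set w | A (fun n => X1 n w)] = P2 [set w | A (fun n => X2 n w)].

Section one_space.
Context (R : realType) (d0 d : measure_display).
Context (T : measurableType d0) (Omega : measurableType d).
Variable mu : probability Omega R.
Implicit Types (xi : nat -> {RV mu >-> T}) (F : set (set Omega)).

(* The sub-sigma-algebra generated by the [xi i], [i \in I], completed inside
   the ambient sigma-algebra: all measurable null sets are adjoined. *)
Definition sigma_rv xi (I : set nat) : set (set Omega) :=
  <<s (\bigcup_(i in I) preimage_set_system setT (xi i) measurable)
      `|` [set N | measurable N /\ mu N = 0%E] >>.

(* [g] is a version of the conditional expectation of [f] given the
   sigma-algebra [F]. *)
Definition is_condexp F (f g : Omega -> R) : Prop :=
  [/\ g \in Lfun mu +oo%E,
      forall B : set R, measurable B -> F (g @^-1` B) &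
      forall A, F A ->
        (\int[mu]_(x in A) (g x)%:E = \int[mu]_(x in A) (f x)%:E)%E].

(* For [f] in L^oo and [F] a sub-sigma-algebra of the measurable sets, a version
   exists and is unique up to a.e. equality; the chosen one depends on the a.e.
   class of [f] only. The default value [cst 0] is irrelevant in this case. *)
Definition condexp F (f : Omega -> R) : Omega -> R :=
  xget (cst 0) [set g | is_condexp F f g].

Definition stationary xi : Prop :=
  forall n, (1 <= n)%N -> same_law xi (fun k => xi (n + k)%N).

Definition markov_sequence xi : Prop :=
  forall (n : nat) (f : Omega -> R), f \in Lfun mu +oo%E ->
    {ae mu, forall w,
      condexp (sigma_rv xi [set i | (i <= n)%N])
        (condexp (sigma_rv xi [set n.+1]) f) w =
      condexp (sigma_rv xi [set n])
        (condexp (sigma_rv xi [set n.+1]) f) w}.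

Definition measure_preserving (eta : Omega -> Omega) : Prop :=
  forall A, measurable A -> mu (eta @^-1` A) = mu A.

Definition almost_invariant (eta : Omega -> Omega) : set (set Omega) :=
  [set A | measurable A /\ mu (A `+` (eta @^-1` A)) = 0%E].

(* All the identities between maps hold everywhere, not just a.e. *)
Definition partial_spreading xi (eta : nat -> {mfun Omega >-> Omega}) : Prop :=
  [/\ forall n, measure_preserving (eta n),
      forall k l, (k < l)%N -> eta l \o eta k =1 eta k \o eta l.+1,
      forall k, (0 < k)%N -> xi 0%N =1 xi 0%N \o eta k &
      forall n, xi n =1 xi 0%N \o iter n (eta 0%N)].

End one_space.

Definition maximal_partially_spreadable (R : realType) (d0 d : measure_display)
    (T : measurableType d0) (Omega : measurableType d)
    (mu : probability Omega R) (xi : nat -> {RV mu >-> T}) : Prop :=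
  exists (d' : measure_display) (Omega' : measurableType d')
         (mu' : probability Omega' R) (xi' : nat -> {RV mu' >-> T})
         (eta : nat -> {mfun Omega' >-> Omega'}),
    [/\ standard_borel R Omega',
        same_law xi xi',
        partial_spreading xi' eta &
        sigma_rv xi' [set 0%N] =
          \bigcap_(k in [set k | (1 <= k)%N]) almost_invariant mu' (eta k)].

(* Main.v *)
(* (a) => (b). Put theta = eta_0^n. An event B of the past of n is invariant
   under eta_k for k > n, so its conditional probability given theta has the
   form u o theta with u invariant under eta_k for all k >= 1; by maximality u
   is a function of xi_0. Integrating q(xi_{n+1}) = q(xi_1) o theta over B thus
   amounts to integrating q(xi_1) against a function of xi_0, where it can be
   replaced by h(xi_0), h being the transition of q from time 0 to time 1.

   (b) => (a). A Markov transition can be written xi_1 = phi(xi_0, t) in law,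
   with t uniform on [0, 1). On the product of the state space with an array of
   fair coins, eta_0 feeds the first row of coins to phi and drops it, while
   eta_{k+1} deletes row k and keeps the state. An eta_1-invariant event is, for
   each fixed state, invariant under the Bernoulli shift of the rows, hence
   trivial by the zero-one law; so it depends on the state only. The model is
   carried to the real line by a measurable coding with a measurable left
   inverse. A stationary Markov sequence is determined in law by its first two
   terms, hence the model has the law of xi. *)
Require Import Defs.
From HB Require Import structures.
From mathcomp Require Import all_boot all_order all_algebra.
From mathcomp Require Import all_classical all_reals all_analysis.
From mathcomp Require Import measurable_realfun ess_sup_inf.
From mathcomp Require Import ring lra.

Set Implicit Arguments.
Unset Strict Implicit.
Unset Printing Implicit Defensive.

Import Order.TTheory GRing.Theory Num.Theory.
Import numFieldNormedType.Exports.

Local Open Scope classical_set_scope.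
Local Open Scope ring_scope.

(** The definitions combine chosen versions of conditional expectations, completed sigma-algebras
    and identities that must hold at every point. Conditional expectations are therefore traded for
    functions on the state space with bounds valid everywhere ([conditioning]), and the Markov
    property for [markov_law], which is tested on uncompleted events of the past and depends on the
    law of the process only.

    No transition kernel is formed. The next state is coded by bits, a conditional probability is
    chosen for each of the countably many finite prefixes, and these choices are consistent for
    almost all states simultaneously. Exceptional states do no harm: the decoder is a total
    function, and the relations between the maps come from the combinatorics of the rows alone,
    whatever [phi] is. This is how they can hold at every point.

    The real line is a carrier that is visibly standard Borel. The coding into it is injective but
    not onto, and a decoder defined on all reals lets the maps act off its image as well. *)

Lemma finite_measureP (R : realType) d (T : measurableType d)
    (nu1 : {measure set T -> \bar R}) : fin_num_fun nu1 ->
  exists nu : {finite_measure set T -> \bar R}, forall A, nu A = nu1 A.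
Proof.
move=> fin.
have oo : (nu1 setT < +oo)%E by rewrite -ge0_fin_numE // fin.
exists (mfrestr (@measurableT _ T) oo) => A.
by rewrite -[LHS]/(nu1 (A `&` setT)) setIT.
Qed.

(** * Densities and conditioning of bounded functions *)

Section density.
Context (R : realType) (d : measure_display) (T : measurableType d).
Variables (mu : {finite_measure set T -> \bar R}) (f : T -> R) (M : R).
Hypotheses (mf : measurable_fun setT f) (f0 : forall x, 0 <= f x)
  (fM : forall x, f x <= M).
Local Open Scope ereal_scope.

(** The bound [M] makes the measure with density [f] finite, so its Radon-Nikodym derivative exists;
    that derivative equals [f] almost everywhere, and its change of variables formula carries over
    to [f]. *)
Lemma density_measure : exists nu : {finite_measure set T -> \bar R},
  (forall A, measurable A -> nu A = \int[mu]_(x in A) (f x)%:E) /\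
  forall g : T -> \bar R, measurable_fun setT g -> (forall x, 0 <= g x) ->
    \int[nu]_x g x = \int[mu]_x (g x * (f x)%:E).
Proof.
pose nu0 := fun A : set T => \int[mu]_(x in A) (f x)%:E.
have mEf : measurable_fun setT (EFin \o f) by exact/measurable_EFinP.
have nu00 : nu0 set0 = 0 by rewrite /nu0 integral_set0.
have nu0_ge0 A : 0 <= nu0 A by apply: integral_ge0 => x _; rewrite lee_fin.
have nu0_add : semi_sigma_additive nu0.
  by apply: semi_sigma_additive_nng_induced => // x; rewrite lee_fin.
have f_int : mu.-integrable setT (EFin \o f).
  apply: measurable_bounded_integrable => //.
    by rewrite -ge0_fin_numE // fin_num_measure.
  exists M; split; first exact: num_real.
  by move=> y My x _; rewrite /= ger0_norm // (le_trans (fM x)) // ltW.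
have nu0_fin : fin_num_fun nu0.
  move=> A mA; apply: integrable_fin_num => //.
  exact: integrableS f_int.
have [nu1 nu1E] : exists nu1 : {measure set T -> \bar R}, forall A, nu1 A = nu0 A.
  by exists (HB.pack_for (measure T R) nu0
    (isMeasure.Build _ _ _ nu0 nu00 nu0_ge0 nu0_add)).
have nu1_fin : fin_num_fun nu1 by move=> A mA; rewrite nu1E; exact: nu0_fin.
have [nu nuE] := finite_measureP nu1_fin.
exists nu; split => [A mA|g]; first by rewrite nuE nu1E.
move=>  mg g0.
have numu : nu `<< mu.
  apply/null_content_dominatesP => A mA muA0; rewrite nuE nu1E.
  by apply: null_set_integral => //; exact: measurable_funTS mEf.
pose h := Radon_Nikodym_SigmaFinite.f nu mu.
have fh : ae_eq mu setT (EFin \o f) h.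
  apply: integral_ae_eq => //.
    by apply: measurable_int; exact: Radon_Nikodym_SigmaFinite.f_integrable.
  by move=> E _ mE; rewrite -Radon_Nikodym_SigmaFinite.f_integral // nuE nu1E.
rewrite -(Radon_Nikodym_SigmaFinite.change_of_variables numu) //.
apply: ge0_ae_eq_integral => //.
- apply: emeasurable_funM => //.
  by apply: measurable_int; exact: Radon_Nikodym_SigmaFinite.f_integrable.
- exact: emeasurable_funM.
- by move=> x _; rewrite mule_ge0 // Radon_Nikodym_SigmaFinite.f_ge0.
- by move=> x _; rewrite mule_ge0 // lee_fin.
- by apply: ae_eqe_mul2l; apply: ae_eq_sym.
Qed.

End density.

Section conditioning.
Context (R : realType) (d d' : measure_display).
Context (Omega : measurableType d) (S : measurableType d').
Variables (P : probability Omega R) (X : {mfun Omega >-> S}).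
Local Open Scope ereal_scope.

(** [h] is the Radon-Nikodym derivative, with respect to the law of [X], of the image under [X] of
    the measure with density [f]. The bounds on [h] hold everywhere, so that [h] can serve again as
    a bounded integrand. *)
Lemma conditioning (f : Omega -> R) (M : R) :
    measurable_fun setT f -> (forall w, 0 <= f w)%R -> (forall w, f w <= M)%R ->
  exists h : S -> R, [/\ measurable_fun setT h,
    (forall s, 0 <= h s)%R, (forall s, h s <= M)%R &
    forall v : S -> \bar R, measurable_fun setT v -> (forall s, 0 <= v s) ->
      \int[P]_w (v (X w) * (f w)%:E) = \int[P]_w (v (X w) * (h (X w))%:E)].
Proof.
move=> mf f0 fM.
have mX : measurable_fun setT X by exact: measurable_funPT.
have [nuf [nufE nufint]] := density_measure P mf f0 fM.
have [nu1 nu1E] : exists nu1 : {measure set S -> \bar R},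
    forall A, nu1 A = nuf (X @^-1` A).
  by unshelve eexists (pushforward nuf X).
have nu1_fin : fin_num_fun nu1.
  move=> A mA; rewrite nu1E fin_num_measure //.
  by rewrite -[X in measurable X]setTI; exact: mX.
have [nu nuE] := finite_measureP nu1_fin.
pose pi : probability S R := distribution P (X : {RV P >-> S}).
have nupi : nu `<< pi.
  apply/null_content_dominatesP => A mA piA; rewrite nuE nu1E nufE; last first.
    by rewrite -[X in measurable X]setTI; exact: mX.
  apply: null_set_integral => //.
    by rewrite -[X in measurable X]setTI; exact: mX.
  exact/measurable_funTS/measurable_EFinP.
pose h0 := Radon_Nikodym_SigmaFinite.f nu pi.
have h0int : pi.-integrable setT h0 by exact: Radon_Nikodym_SigmaFinite.f_integrable.
have h00 s : 0 <= h0 s by exact: Radon_Nikodym_SigmaFinite.f_ge0.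
have mh0 : measurable_fun setT h0 by exact: measurable_int h0int.
(* Truncation secures the upper bound at every point; where [h0] is finite it matters only on the
   set [C] below, which turns out to be null. *)
pose h s := Num.min (fine (h0 s)) M.
have M0 : (0 <= M)%R by rewrite (le_trans (f0 point)).
have mh : measurable_fun setT h.
  apply: measurable_minr => //; apply: measurableT_comp => //.
have nuv v : measurable_fun setT v -> (forall s, 0 <= v s) ->
    \int[P]_w (v (X w) * (f w)%:E) = \int[pi]_s (v s * h0 s).
  move=> mv v0; rewrite (Radon_Nikodym_SigmaFinite.change_of_variables nupi) //.
  rewrite -(nufint (v \o X)); [|exact: measurableT_comp|by move=> w; exact: v0].
  rewrite (eq_measure_integral (pushforward nuf X)); last first.
    by move=> A mA _; exact: etrans (nuE A) (nu1E A).
  by rewrite ge0_integral_pushforward.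
exists h; split => // [s|s|v mv v0].
- by rewrite le_min M0 andbT fine_ge0.
- by rewrite ge_min lexx orbT.
pose C := [set s | M%:E < h0 s].
have mC : measurable C.
  by rewrite -[C]setTI; exact: emeasurable_fun_o_infty.
(* Since [f] is at most [M], the integral of [h0] over [C] is at most [M%:E * pi C]; the excess of
   [h0] over [M], positive on [C], thus integrates to 0. *)
have intC : \int[pi]_(s in C) (h0 s - M%:E) = 0.
  have : \int[pi]_(s in C) (h0 s - M%:E) + M%:E * pi C <= M%:E * pi C.
    rewrite -integral_cst // -ge0_integralD //; last 2 first.
    - by move=> s Cs; rewrite sube_ge0 // ltW.
    - by apply: emeasurable_funB => //; exact: measurable_funTS.
    under eq_integral do rewrite subeK //.
    rewrite integral_cst // -[leLHS](Radon_Nikodym_SigmaFinite.f_integral nupi) //.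
    rewrite nuE nu1E nufE; last by rewrite -[X in measurable X]setTI; exact: mX.
    rewrite -[leRHS]/(M%:E * P (X @^-1` C)) -integral_cst //; last first.
      by rewrite -[X in measurable X]setTI; exact: mX.
    apply: ge0_le_integral => //.
    - by rewrite -[X in measurable X]setTI; exact: mX.
    - by move=> w _; rewrite lee_fin.
    - by apply: measurable_funTS; exact/measurable_EFinP.
    - by move=> w _; rewrite lee_fin.
  rewrite -leeBrDr ?fin_numM ?fin_num_measure // subee ?fin_numM ?fin_num_measure //.
  move=> le0; apply/eqP; rewrite eq_le le0 /=.
  by apply: integral_ge0 => s Cs; rewrite EFinN sube_ge0 // ltW.
have h0M : {ae pi, forall s, h0 s <= M%:E}.
  have [|aeC _] := ae_eq_integral_abs pi mC (f := fun s => h0 s - M%:E).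
    by apply: emeasurable_funB => //; exact: measurable_funTS.
  have [|N [mN N0 CN]] := aeC.
    rewrite -[RHS]intC; apply: eq_integral => s; rewrite inE => Cs.
    by rewrite gee0_abs // sube_ge0 // ltW.
  exists N; split => // s /= /negP; rewrite -ltNge => Cs.
  apply: CN => /= /(_ Cs) hM; have : 0 < h0 s - M%:E by rewrite sube_gt0.
  by rewrite [_ - _]hM ltxx.
rewrite nuv //.
transitivity (\int[pi]_s (v s * (h s)%:E)).
  apply: ge0_ae_eq_integral => //.
  - exact: emeasurable_funM.
  - by apply: emeasurable_funM => //; exact/measurable_EFinP.
  - by move=> s _; rewrite mule_ge0.
  - by move=> s _; rewrite mule_ge0 // lee_fin le_min M0 andbT fine_ge0.
  apply: filterS h0M => s hM _; congr (_ * _); rewrite /h EFin_min fineK.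
    by apply/esym; apply/min_idPl.
  exact: Radon_Nikodym_SigmaFinite.f_fin_num.
rewrite ge0_integral_distribution //.
  apply: emeasurable_funM => //; exact/measurable_EFinP.
by move=> s; rewrite mule_ge0 // lee_fin le_min M0 andbT fine_ge0.
Qed.

End conditioning.

(** * Completed sigma-algebras and versions of conditional expectations *)

Section completed_sigma.
Context (R : realType) (d d' : measure_display).
Context (Omega : measurableType d) (S : measurableType d').
Variable mu : probability Omega R.

Definition completed_sigma (X : Omega -> S) : set (set Omega) :=
  [set A | measurable A /\
    exists2 C, measurable C & mu (A `+` X @^-1` C) = 0%E].

Lemma measure_setYP (A B : set Omega) : measurable A -> measurable B ->
  mu (A `+` B) = 0%E <-> mu (A `\` B) = 0%E /\ mu (B `\` A) = 0%E.
Proof.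
move=> mA mB; have mAB := measurableD mA mB; have mBA := measurableD mB mA.
split=> [AB0|[AB0 BA0]].
  by split; apply: (subset_measure0 _ _ _ AB0) => //;
    [exact: measurableU|exact: subsetUl|exact: measurableU|exact: subsetUr].
apply/eqP; rewrite -measure_le0 -[leRHS]adde0 -[X in (X + _)%E]AB0 -BA0.
exact: measureU2.
Qed.

Lemma integral_setY0 (A B : set Omega) (u : Omega -> \bar R) :
  measurable A -> measurable B -> mu (A `+` B) = 0%E ->
  measurable_fun setT u ->
  (\int[mu]_(w in A) u w = \int[mu]_(w in B) u w)%E.
Proof.
move=> mA mB AB0 mf; rewrite integral_mkcond [RHS]integral_mkcond.
apply: ae_eq_integral => //.
- by apply/measurable_restrict => //; rewrite setIidr //; exact: measurable_funTS.
- by apply/measurable_restrict => //; rewrite setIidr //; exact: measurable_funTS.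
exists (A `+` B); split => //.
  by apply: measurableU; exact: measurableD.
move=> w /= /not_implyP[_]; rewrite !patchE; apply: contra_notP.
move=> /not_orP[/not_andP nAB /not_andP nBA].
case: ifPn; case: ifPn => //; rewrite ?inE ?notin_setE //; tauto.
Qed.

Variable X : {mfun Omega >-> S}.

Let mX C : measurable C -> measurable (X @^-1` C).
Proof. by move=> mC; rewrite -[_ @^-1` _]setTI; exact: measurable_funPT. Qed.

Lemma completed_sigma_sub : completed_sigma X `<=` measurable.
Proof. by move=> A []. Qed.

Lemma completed_sigma_algebra : sigma_algebra setT (completed_sigma X).
Proof.
split.
- by split => //; exists set0 => //; rewrite preimage_set0 setYK measure0.
- move=> A [mA [C mC AC]]; rewrite setTD; split; first exact: measurableC.
  exists (~` C); first exact: measurableC.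
  rewrite preimage_setC (_ : _ `+` _ = A `+` X @^-1` C) //.
  by rewrite /setY !setDE !setCK setUC; congr (_ `|` _); rewrite setIC.
- move=> A FA.
  have /choice[C CP] : forall i, exists C, measurable C /\ mu (A i `+` X @^-1` C) = 0%E.
    by move=> i; have [_ [C mC AC]] := FA i; exists C.
  have mA i : measurable (A i) by have [] := FA i.
  split; first exact: bigcupT_measurable.
  exists (\bigcup_i C i); first by apply: bigcupT_measurable => i; have [] := CP i.
  apply: (subset_measure0 (B := \bigcup_i (A i `+` X @^-1` C i))).
  + apply: measurableU; apply: measurableD; do ?[apply: mX];
      apply: bigcupT_measurable => // i; by have [] := CP i.
  + apply: bigcupT_measurable => i; have [mCi _] := CP i.
    by apply: measurableU; apply: measurableD => //; exact: mX.
  + rewrite preimage_bigcup => w [[[i _ Aw] nC]|[[i _ Cw] nA]].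
      by exists i => //; left; split => // Cw; apply: nC; exists i.
    by exists i => //; right; split => // Aw; apply: nA; exists i.
  + apply/negligibleP.
      apply: bigcupT_measurable => i; have [mCi _] := CP i.
      by apply: measurableU; apply: measurableD => //; exact: mX.
    apply: negligible_bigcup => i; have [mCi AC0] := CP i; apply/negligibleP => //.
    by apply: measurableU; apply: measurableD => //; exact: mX.
Qed.

(** The sets equal to a preimage under [X] up to a null set form a sigma-algebra, which gives one
    inclusion. Conversely such a set is its preimage minus one null set plus another, and null sets
    are generators. *)
Lemma g_completed_sigma (G : set (set S)) : measurable = <<s G >> ->
  <<s preimage_set_system setT X G `|` [set N | measurable N /\ mu N = 0%E] >> =
  completed_sigma X.
Proof.
move=> SG; apply/seteqP; split.
  apply: smallest_sub; first exact: completed_sigma_algebra.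
  move=> A [[C GC <-]|[mN N0]].
    have mC : measurable C by rewrite SG; exact: sub_sigma_algebra.
    rewrite setTI; split; first exact: mX.
    by exists C => //; rewrite setYK measure0.
  by split => //; exists set0 => //; rewrite preimage_set0 setY0.
move=> A [mA [C mC /(measure_setYP mA (mX mC))[AC0 CA0]]].
set F := <<s _ >>.
have FS : sigma_algebra setT F by exact: smallest_sigma_algebra.
have FN N : measurable N -> mu N = 0%E -> F N.
  by move=> mN N0; apply: sub_sigma_algebra; right.
have FXC : F (X @^-1` C).
  move: mC; rewrite SG; move: C {AC0 CA0}.
  apply: smallest_sub; last first.
    by move=> C GC; apply: sub_sigma_algebra; left; exists C => //; rewrite setTI.
  split => /=.
  - by rewrite preimage_set0; apply: sigma_algebra0.
  - by move=> C FC; rewrite setTD preimage_setC; exact: sigma_algebraC.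
  - by move=> C FC; rewrite preimage_bigcup; exact: sigma_algebra_bigcup.
rewrite (_ : A = (X @^-1` C `\` (X @^-1` C `\` A)) `|` (A `\` X @^-1` C)).
  pose FT : measurableType _ :=
    g_sigma_algebraType (preimage_set_system setT X G `|` [set N | measurable N /\ mu N = 0%E]).
  have FU : setU_closed F := @measurableU _ FT.
  have FD : setD_closed F := @measurableD _ FT.
  have XCA := measurableD (mX mC) mA; have AXC := measurableD mA (mX mC).
  by apply: FU; [apply: FD => //|]; exact: FN.
apply/seteqP; split => w /=; last first.
  by move=> [[Cw nCA]|[]//]; apply: contrapT => nA; exact: nCA.
move=> Aw; have [Cw|nCw] := pselect (C (X w)); [left|right] => //.
by split => // -[].
Qed.

End completed_sigma.

Section condexp_theory.
Context (R : realType) (d : measure_display) (Omega : measurableType d).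
Variable mu : probability Omega R.
Implicit Types (f g : Omega -> R) (F : set (set Omega)).

Lemma Lfun_bounded f (M : R) : measurable_fun setT f -> (forall w, `|f w| <= M) ->
  f \in Lfun mu +oo%E.
Proof.
move=> mf fM; rewrite inE; apply/andP; split; rewrite inE //=.
rewrite /finite_norm unlock /Lnorm; case: ifPn => // _.
apply: (@le_lt_trans _ _ M%:E); last exact: ltry.
by apply: ess_sup_ler => w; rewrite lee_fin.
Qed.

Lemma LfunP_bounded f : f \in Lfun mu +oo%E -> measurable_fun setT f /\
  exists2 M : R, 0 <= M & {ae mu, forall w, `|f w| <= M}.
Proof.
rewrite inE => /andP[]; rewrite !inE /= => mf.
have mu1 : (0 < mu setT)%E by rewrite probability_setT lte01.
rewrite /finite_norm unlock /Lnorm; case: ifPn => [_ fin|/negP/(_ mu1)//].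
split => //.
have [M fM] := ess_supr_bounded fin.
exists (Num.max M 0); first by rewrite le_max lexx orbT.
by apply: filterS fM => w /= fwM; rewrite le_max fwM.
Qed.

Lemma bounded_integrable f (M : R) (A : set Omega) : measurable A ->
  measurable_fun setT f -> (forall w, `|f w| <= M) ->
  mu.-integrable A (EFin \o f).
Proof.
move=> mA mf fM; apply: measurable_bounded_integrable => //.
- by rewrite -ge0_fin_numE // fin_num_measure.
- exact: measurable_funTS.
exists M; split; first exact: num_real.
by move=> y My x _; rewrite /= (le_trans (fM x)) // ltW.
Qed.

Lemma Lfun_oo_integrable f (A : set Omega) : measurable A ->
  f \in Lfun mu +oo%E -> mu.-integrable A (EFin \o f).
Proof.
move=> mA /LfunP_bounded[mf [M M0 fM]].
have mEf : measurable_fun setT (EFin \o f) by exact/measurable_EFinP.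
apply/integrableP; split; first exact: measurable_funTS.
apply: (@le_lt_trans _ _ (\int[mu]_(w in A) (cst M%:E w))%E).
  apply: ae_ge0_le_integral => //.
  - by apply: measurableT_comp => //; exact: measurable_funTS.
  - by apply: filterS fM => w fwM _; rewrite /= lee_fin.
by rewrite integral_cst // ltey_eq fin_numM // fin_num_measure.
Qed.

(** The set where [g2 < g1] belongs to [F], and both integrals over it equal that of [f], so this
    set is null. Symmetry gives the other inequality. *)
Lemma is_condexp_unique F f g1 g2 :
  sigma_algebra setT F -> F `<=` measurable ->
  is_condexp mu F f g1 -> is_condexp mu F f g2 ->
  {ae mu, forall w, g1 w = g2 w}.
Proof.
move=> sF Fm.
wlog suff : g1 g2 / is_condexp mu F f g1 -> is_condexp mu F f g2 ->
    {ae mu, forall w, g1 w <= g2 w}.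
  move=> H c1 c2; have := H _ _ c1 c2; have := H _ _ c2 c1.
  apply: filterS2 => w le1 le2; apply/eqP; rewrite eq_le; exact/andP.
move=> [L1 m1 i1] [L2 m2 i2].
have [mg1 _] := LfunP_bounded L1; have [mg2 _] := LfunP_bounded L2.
pose A := [set w | g2 w < g1 w].
pose FT : measurableType F.-sigma := g_sigma_algebraType F.
have FE : @measurable _ FT = F by exact: sigma_algebra_id.
have mFT g : (forall B, measurable B -> F (g @^-1` B)) ->
    measurable_fun setT (g : FT -> R).
  by move=> mg _ B mB; rewrite setTI FE; exact: mg.
have FA : F A.
  rewrite -FE -[A]setTI.
  rewrite (_ : A = (fun w => g2 w < g1 w) @^-1` [set true]) //.
  exact: (measurable_fun_ltr (mFT _ m2) (mFT _ m1)).
have mA := Fm _ FA.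
have I1 := Lfun_oo_integrable mA L1; have I2 := Lfun_oo_integrable mA L2.
have [|ae0 _] := ae_eq_integral_abs mu mA (f := fun w => (g1 w - g2 w)%:E).
  by apply/measurable_EFinP; apply: measurable_funTS; exact: measurable_funB.
have [|N [mN N0 AN]] := ae0.
  transitivity (\int[mu]_(w in A) ((g1 w)%:E - (g2 w)%:E))%E.
    apply: eq_integral => w; rewrite inE => Aw.
    by rewrite gee0_abs ?EFinB // lee_fin subr_ge0 ltW.
  by rewrite integralB // i1 // i2 // subee // -i1 // integrable_fin_num.
exists N; split => // w /= /negP; rewrite -ltNge => Aw; apply: AN => /= /(_ Aw).
by move=> [/eqP]; rewrite subr_eq0 gt_eqF.
Qed.

Lemma is_condexpP F f g : is_condexp mu F f g ->
  is_condexp mu F f (condexp mu F f).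
Proof. by move=> fg; apply: xgetPex; exists g. Qed.

(** Together with [is_condexpP] this is the only access to the chosen version: exhibiting one
    version excludes the default value, and the chosen one then agrees with it almost everywhere. *)
Lemma condexp_ae F f g : sigma_algebra setT F -> F `<=` measurable ->
  is_condexp mu F f g -> {ae mu, forall w, condexp mu F f w = g w}.
Proof.
by move=> sF Fm fg; exact: is_condexp_unique sF Fm (is_condexpP fg) fg.
Qed.

Lemma is_condexp_id F f : f \in Lfun mu +oo%E ->
  (forall B, measurable B -> F (f @^-1` B)) -> is_condexp mu F f f.
Proof. by move=> Lf mf; split. Qed.

Lemma is_condexp_congr F f f' g : F `<=` measurable ->
  measurable_fun setT f -> measurable_fun setT f' ->
  {ae mu, forall w, f w = f' w} -> is_condexp mu F f g -> is_condexp mu F f' g.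
Proof.
move=> Fm mf mf' ff' [Lg mg ig]; split => // A FA; rewrite ig //.
apply: ae_eq_integral => //; first exact: Fm.
- by apply: measurable_funTS; exact/measurable_EFinP.
- by apply: measurable_funTS; exact/measurable_EFinP.
by apply: filterS ff' => w -> _.
Qed.

End condexp_theory.

Section condexp_completed_sigma.
Context (R : realType) (d d' : measure_display).
Context (Omega : measurableType d) (S : measurableType d').
Variables (mu : probability Omega R) (X : {mfun Omega >-> S}).

Let mX C : measurable C -> measurable (X @^-1` C).
Proof. by move=> mC; rewrite -[_ @^-1` _]setTI; exact: measurable_funPT. Qed.

(** Testing on preimages under [X] suffices, as each set of the completed sigma-algebra is one of
    them up to a null set, which integrals do not see. *)
Lemma is_condexp_completed (f g : Omega -> R) :
  f \in Lfun mu +oo%E -> g \in Lfun mu +oo%E ->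
  (forall B, measurable B -> completed_sigma mu X (g @^-1` B)) ->
  (forall C, measurable C ->
    (\int[mu]_(w in X @^-1` C) (g w)%:E = \int[mu]_(w in X @^-1` C) (f w)%:E)%E) ->
  is_condexp mu (completed_sigma mu X) f g.
Proof.
move=> Lf Lg mg fg; have [mf _] := LfunP_bounded Lf.
have [mg' _] := LfunP_bounded Lg.
split => // A [mA [C mC AC]].
rewrite !(integral_setY0 mA (mX mC) AC); [exact: fg|exact/measurable_EFinP..].
Qed.

Lemma completed_sigma_comp (h : S -> R) B : measurable_fun setT h ->
  measurable B -> completed_sigma mu X ((h \o X) @^-1` B).
Proof.
move=> mh mB; have mhB : measurable (h @^-1` B).
  by rewrite -[_ @^-1` _]setTI; exact: mh.
rewrite comp_preimage; split; first exact: mX.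
by exists (h @^-1` B) => //; rewrite setYK measure0.
Qed.


Lemma conditioning_set (f : Omega -> R) (h : S -> R) :
  (forall v : S -> \bar R, measurable_fun setT v -> (forall s, 0 <= v s)%E ->
      \int[mu]_w (v (X w) * (f w)%:E) = \int[mu]_w (v (X w) * (h (X w))%:E))%E ->
  forall C, measurable C -> (\int[mu]_(w in X @^-1` C) (f w)%:E =
    \int[mu]_(w in X @^-1` C) (h (X w))%:E)%E.
Proof.
move=> fh C mC; rewrite integral_mkcond [RHS]integral_mkcond !epatch_indic.
under eq_integral do rewrite muleC; under [RHS]eq_integral do rewrite muleC.
apply: (fh (EFin \o \1_C)); first exact/measurable_EFinP.
by move=> s; rewrite lee_fin.
Qed.

(** Takes back a shift: [conditioning] handles nonnegative functions, and signed bounded ones are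
    first raised by a constant. *)
Lemma integralD_cst (f g : Omega -> R) (M c : R) A : measurable A ->
  measurable_fun setT f -> measurable_fun setT g ->
  (forall w, `|f w| <= M) -> (forall w, `|g w| <= M) ->
  (\int[mu]_(w in A) (f w + c)%:E = \int[mu]_(w in A) (g w + c)%:E)%E ->
  (\int[mu]_(w in A) (f w)%:E = \int[mu]_(w in A) (g w)%:E)%E.
Proof.
move=> mA mf mg fM gM.
have cD (u : Omega -> R) : measurable_fun setT u -> (forall w, `|u w| <= M) ->
    (\int[mu]_(w in A) (u w + c)%:E = \int[mu]_(w in A) (u w)%:E + c%:E * mu A)%E.
  move=> mu' uM; rewrite -integral_cst // -integralD //.
  - exact: bounded_integrable uM.
  - exact: finite_measure_integrable_cst.
have If := bounded_integrable mu mA mf fM.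
have Ig := bounded_integrable mu mA mg gM.
rewrite !cD // => /(congr1 (fun x => x - c%:E * mu A)%E).
by rewrite !addeK // fin_numM // fin_num_measure.
Qed.

(** An essentially bounded [f] is clipped to [[-M, M]], which changes it on a null set only, raised
    by [M] to become nonnegative, conditioned, and lowered again. *)
Lemma condexp_exists (f : Omega -> R) : f \in Lfun mu +oo%E ->
  exists (h : S -> R) (M : R), [/\ measurable_fun setT h,
    (forall s, `|h s| <= M) & is_condexp mu (completed_sigma mu X) f (h \o X)].
Proof.
move=> Lf; have [mf [M M0 fM]] := LfunP_bounded Lf.
pose f1 w : R := Num.max (- M) (Num.min (f w) M).
have mf1 : measurable_fun setT f1.
  by apply: measurable_maxr => //; exact: measurable_minr.
have f1M w : `|f1 w| <= M.
  have NM : - M <= M by rewrite -subr_ge0 opprK addr_ge0.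
  by rewrite ler_norml le_max lexx ge_max NM ge_min lexx orbT.
have f1f : {ae mu, forall w, f1 w = f w}.
  apply: filterS fM => w; rewrite ler_norml => /andP[Mf fM].
  by rewrite /f1 min_l // max_r.
have [|||h' [mh' h'0 h'M h'E]] := @conditioning _ _ _ _ _ mu X (fun w => f1 w + M) (M + M).
- exact: measurable_funD.
- by move=> w; rewrite -lerBlDr sub0r; have := f1M w; rewrite ler_norml => /andP[].
- by move=> w; rewrite lerD2r; have := f1M w; rewrite ler_norml => /andP[].
pose h s : R := h' s - M.
have mh : measurable_fun setT h by exact: measurable_funB.
have hM s : `|h s| <= M.
  by rewrite ler_norml lerBrDr addNr h'0 lerBlDr h'M.
have mhX : measurable_fun setT (h \o X).
  by apply: measurableT_comp => //; exact: measurable_funPT.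
exists h, M; split => //.
apply: (@is_condexp_congr _ _ _ _ _ f1) => //.
  exact: completed_sigma_sub.
apply: is_condexp_completed => //.
- exact: Lfun_bounded f1M.
- by apply: (@Lfun_bounded _ _ _ _ _ M) => // w; exact: hM.
- by move=> B mB; exact: completed_sigma_comp.
move=> C mC; apply: (@integralD_cst _ _ M M) => //; first exact: mX.
- by move=> w; exact: hM.
rewrite (conditioning_set h'E mC); apply: eq_integral => w _.
by rewrite /= subrK.
Qed.

End condexp_completed_sigma.

(** * Path spaces and the Markov property in integrated form *)

Section coordinates.
Context (J : Type) (d : measure_display) (T : measurableType d) (I : set J).

Definition coord_gen : set (set (J -> T)) :=
  \bigcup_(i in I) preimage_set_system setT (fun x : J -> T => x i) measurable.

(** The carrier keeps all coordinates while only those in [I] generate the sigma-algebra, so one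
    type of paths serves for the past, for the whole time axis and for coins. *)
Definition coord_space := g_sigma_algebraType coord_gen.

Lemma measurable_coord_proj i : I i ->
  measurable_fun setT ((fun x => x i) : coord_space -> T).
Proof.
by move=> Ii _ B mB; apply: sub_sigma_algebra; exists i => //; exists B.
Qed.

Lemma measurable_coord_fun d' (Omega : measurableType d') (f : Omega -> J -> T) :
  (forall i, I i -> measurable_fun setT (f ^~ i)) ->
  measurable_fun setT (f : Omega -> coord_space).
Proof.
move=> mf; apply: (@measurability _ _ Omega coord_space setT f coord_gen) => //.
move=> _ [_ [i Ii [B mB <-]] <-]; rewrite !setTI.
by rewrite -[X in measurable X]setTI; exact: (mf i Ii).
Qed.

(** The sets that cannot separate two points agreeing on [I] form a sigma-algebra containing the
    generators. This makes events of the past invariant at every point under maps that fix the past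
    coordinates. *)
Lemma coord_dep (A : set (J -> T)) : <<s coord_gen >> A ->
  forall x y : J -> T, (forall i, I i -> x i = y i) -> A x -> A y.
Proof.
pose D := [set A : set (J -> T) | forall x y : J -> T,
  (forall i, I i -> x i = y i) -> A x -> A y].
suff : <<s coord_gen >> `<=` D by exact.
apply: smallest_sub; first split => /=.
- by [].
- move=> B DB; rewrite setTD => x y xy nBx By; apply: nBx; apply: DB By.
  by move=> i Ii; rewrite xy.
- by move=> B DB x y xy [i _ Bx]; exists i => //; exact: DB xy Bx.
by move=> _ [i Ii [B mB <-]] x y xy [_ /=]; rewrite xy // => By; split.
Qed.

End coordinates.
Arguments coord_gen {J d} T I.
Arguments coord_space {J d} T I.

Lemma coord_gen_sub J d (T : measurableType d) (I I' : set J) : I `<=` I' ->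
  <<s coord_gen T I >> `<=` <<s coord_gen T I' >>.
Proof.
move=> II'; apply: sub_sigma_algebra2 => _ [i Ii [B mB <-]].
by exists i; [exact: II'|exists B].
Qed.

Section path_map.
Context (R : realType) (d0 d : measure_display).
Context (T : measurableType d0) (Omega : measurableType d).
Variables (mu : probability Omega R) (xi : nat -> {RV mu >-> T}) (I : set nat).

Definition path_map : Omega -> coord_space T I := fun w n => xi n w.

Lemma measurable_path_map : measurable_fun setT path_map.
Proof. by apply: measurable_coord_fun => i _; exact: measurable_funPT. Qed.

HB.instance Definition _ := isMeasurableFun.Build _ _ _ _ path_map
  measurable_path_map.

Lemma measurable_path_event A : <<s coord_gen T I >> A ->
  measurable [set w | A (fun n => xi n w)].
Proof.
move=> mA; rewrite -[X in measurable X]setTI.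
exact: (measurable_path_map measurableT mA).
Qed.

Lemma sigma_rvE : sigma_rv xi I = completed_sigma mu path_map.
Proof.
rewrite -(@g_completed_sigma _ _ _ _ (coord_space T I) mu _ (coord_gen T I)) //.
congr (<<s _ `|` _ >>); apply/seteqP; split => A.
  move=> [i Ii [B mB <-]]; exists ((fun x : nat -> T => x i) @^-1` B) => //.
  by exists i => //; exists B => //; rewrite setTI.
by move=> [_ [i Ii [B mB <-]] <-]; exists i => //; exists B => //; rewrite !setTI.
Qed.

End path_map.

Lemma sigma_rv1E (R : realType) (d0 d : measure_display)
  (T : measurableType d0) (Omega : measurableType d)
  (mu : probability Omega R) (xi : nat -> {RV mu >-> T}) n :
  sigma_rv xi [set n] = completed_sigma mu (xi n).
Proof.
rewrite -(@g_completed_sigma _ _ _ _ T mu _ measurable); last first.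
  by rewrite sigma_algebra_id //; exact: sigma_algebra_measurable.
by rewrite /sigma_rv bigcup_set1.
Qed.

Section markov_law.
Context (R : realType) (d0 d : measure_display).
Context (T : measurableType d0) (Omega : measurableType d).
Variables (mu : probability Omega R) (xi : nat -> {RV mu >-> T}).
Local Open Scope ereal_scope.

(** The Markov property freed from versions and completions; [h] is the transition of [q] from time
    [n] to time [n.+1]. Only the law of the process enters, so the property can be moved to another
    probability space. *)
Definition markov_law := forall (n : nat) (q : T -> R) (M : R),
  measurable_fun setT q -> (forall t, 0 <= q t)%R -> (forall t, q t <= M)%R ->
  exists h : T -> R, [/\ measurable_fun setT h,
    (forall t, 0 <= h t)%R, (forall t, h t <= M)%R &
    forall A, <<s coord_gen T [set i | (i <= n)%N] >> A ->
      \int[mu]_(w in [set w | A (fun k => xi k w)]) (q (xi n.+1 w))%:E =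
      \int[mu]_(w in [set w | A (fun k => xi k w)]) (h (xi n w))%:E].

Let Lfun_comp (Y : {mfun Omega >-> T}) (q : T -> R) (M : R) :
  measurable_fun setT q -> (forall t, `|q t| <= M)%R -> q \o Y \in Lfun mu +oo.
Proof.
move=> mq qM; apply: (@Lfun_bounded _ _ _ _ _ M) => [|w]; last exact: qM.
by apply: measurableT_comp => //; exact: measurable_funPT.
Qed.

Lemma markov_sequence_law : markov_sequence xi -> markov_law.
Proof.
move=> Mxi n q M mq q0 qM.
have qM' t : (`|q t| <= M)%R by rewrite ger0_norm.
pose f := q \o xi n.+1.
have mf : measurable_fun setT f.
  by apply: measurableT_comp => //; exact: measurable_funPT.
have Lf : f \in Lfun mu +oo by exact: Lfun_comp qM'.
have := Mxi n _ Lf; rewrite sigma_rvE !sigma_rv1E.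
set Fn := completed_sigma mu (path_map _ _).
set g := condexp _ (completed_sigma mu (xi n.+1)) f.
(* [f] is a function of [xi n.+1], hence a version of its own conditional expectation: the inner
   operator of the Markov identity changes it on a null set only. *)
have cf : is_condexp mu (completed_sigma mu (xi n.+1)) f f.
  by apply: is_condexp_id => // B mB; exact: completed_sigma_comp.
have cg := is_condexpP cf.
have [Lg _ _] := cg; have [mg _] := LfunP_bounded Lg.
have gf : {ae mu, forall w, g w = f w}.
  apply: condexp_ae cf; first exact: completed_sigma_algebra.
  exact: completed_sigma_sub.
have [h [mh h0 hM hE]] := conditioning mu (xi n) mf (fun w => q0 _) (fun w => qM _).
have hM' t : (`|h t| <= M)%R by rewrite ger0_norm.
move=> EE; exists h; split => // A mA.
have Ln : h \o xi n \in Lfun mu +oo by exact: Lfun_comp hM'.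
have cn : is_condexp mu (completed_sigma mu (xi n)) g (h \o xi n).
  apply: (is_condexp_congr _ mf mg).
  - exact: completed_sigma_sub.
  - by apply: filterS gf.
  apply: is_condexp_completed => //.
  - by move=> B mB; exact: completed_sigma_comp.
  - by move=> C mC; rewrite (conditioning_set hE).
have En : {ae mu, forall w, condexp mu (completed_sigma mu (xi n)) g w = h (xi n w)}.
  apply: condexp_ae cn; first exact: completed_sigma_algebra.
  exact: completed_sigma_sub.
(* Existence of a version given the whole past ensures that the outer [condexp] is one, and not its
   default value. *)
have [k [K [mk kK ck]]] := condexp_exists (path_map xi [set i | (i <= n)%N]) Lg.
have [Lk mk' ik] := is_condexpP ck.
have mA' := measurable_path_event xi mA.
have FA : Fn [set w | A (fun k => xi k w)].
  split => //; exists A; first by [].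
  by rewrite setYK measure0.
transitivity (\int[mu]_(w in [set w | A (fun k => xi k w)]) (g w)%:E).
  apply: ae_eq_integral => //.
  - by apply: measurable_funTS; exact/measurable_EFinP.
  - by apply: measurable_funTS; exact/measurable_EFinP.
  - by apply: filterS gf => w -> _.
rewrite -ik //; apply: ae_eq_integral => //.
- apply: measurable_funTS; apply/measurable_EFinP.
  by have [] := LfunP_bounded Lk.
- apply: measurable_funTS; apply/measurable_EFinP.
  by have [] := LfunP_bounded Ln.
- by apply: filterS2 EE En => w -> -> _.
Qed.

Lemma markov_law_sequence : markov_law -> markov_sequence xi.
Proof.
move=> Mxi n f Lf; rewrite sigma_rvE !sigma_rv1E.
set g := condexp _ (completed_sigma mu (xi n.+1)) f.
(* The inner expectation is almost everywhere a bounded function [q0] of [xi n.+1]; adding [M] makes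
   it a nonnegative integrand, as [markov_law] asks. *)
have [q0 [M [mq0 q0M cq]]] := condexp_exists (xi n.+1) Lf.
have [Lg _ _] := is_condexpP cq; have [mg _] := LfunP_bounded Lg.
have [Lq _ _] := cq; have [mqX _] := LfunP_bounded Lq.
have gq : {ae mu, forall w, q0 (xi n.+1 w) = g w}.
  have := condexp_ae (completed_sigma_algebra mu (xi n.+1))
    (@completed_sigma_sub _ _ _ _ _ mu (xi n.+1)) cq.
  by apply: filterS => w /esym.
have [|||h [mh h0 hM hE]] := Mxi n (fun t => q0 t + M)%R (M + M)%R.
- exact: measurable_funD.
- by move=> t; rewrite -lerBlDr sub0r; have := q0M t; rewrite ler_norml => /andP[].
- by move=> t; rewrite lerD2r; have := q0M t; rewrite ler_norml => /andP[].
pose h' s : R := (h s - M)%R.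
have mh' : measurable_fun setT h' by exact: measurable_funB.
have h'M s : (`|h' s| <= M)%R.
  by rewrite ler_norml lerBrDr addNr h0 lerBlDr hM.
have Lh : h' \o xi n \in Lfun mu +oo by exact: Lfun_comp h'M.
have [mhX _] := LfunP_bounded Lh.
have key A : <<s coord_gen T [set i | (i <= n)%N] >> A ->
    \int[mu]_(w in [set w | A (fun k => xi k w)]) (h' (xi n w))%:E =
    \int[mu]_(w in [set w | A (fun k => xi k w)]) (g w)%:E.
  move=> mA; have mA' := measurable_path_event xi mA.
  transitivity (\int[mu]_(w in [set w | A (fun k => xi k w)]) (q0 (xi n.+1 w))%:E).
    apply: (@integralD_cst _ _ _ mu (h' \o xi n) (q0 \o xi n.+1) M M) => //.
    - by move=> w; exact: h'M.
    - by move=> w; exact: q0M.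
    by rewrite (hE _ mA); apply: eq_integral => w _; rewrite /= subrK.
  apply: ae_eq_integral => //.
  - by apply: measurable_funTS; exact/measurable_EFinP.
  - by apply: measurable_funTS; exact/measurable_EFinP.
  - by apply: filterS gq => w -> _.
(* One and the same function [h' \o xi n] is a version given the past and, in [c2], given the
   present; this is the Markov identity. *)
have c1 : is_condexp mu (completed_sigma mu (path_map xi [set i | (i <= n)%N])) g
    (h' \o xi n).
  apply: is_condexp_completed => // B mB.
  have -> : h' \o xi n = (fun x : coord_space T [set i | (i <= n)%N] => h' (x n))
    \o path_map xi [set i | (i <= n)%N] by [].
  apply: completed_sigma_comp => //; apply: measurableT_comp => //.
  by apply: measurable_coord_proj => /=.
have c2 : is_condexp mu (completed_sigma mu (xi n)) g (h' \o xi n).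
  apply: is_condexp_completed => //.
    by move=> B mB; exact: completed_sigma_comp.
  move=> C mC; apply: (key [set x | C (x n)]).
  apply: sub_sigma_algebra; exists n => //=; exists C => //.
  by rewrite setTI.
have := condexp_ae (completed_sigma_algebra mu _) (@completed_sigma_sub _ _ _ _ _ _ _) c1.
have := condexp_ae (completed_sigma_algebra mu _) (@completed_sigma_sub _ _ _ _ _ _ _) c2.
by apply: filterS2 => w -> ->.
Qed.

End markov_law.

(** * From maximal partial spreadability to the stationary Markov property *)

Section measure_preserving_theory.
Context (R : realType) (d : measure_display) (Omega : measurableType d).
Variable mu : probability Omega R.
Local Open Scope ereal_scope.

Lemma ge0_integral_measure_preserving (eta : {mfun Omega >-> Omega})
    (u : Omega -> \bar R) : measure_preserving mu eta ->
  measurable_fun setT u -> (forall w, 0 <= u w) ->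
  \int[mu]_w u (eta w) = \int[mu]_w u w.
Proof.
move=> mp mu' u0; transitivity (\int[pushforward mu eta]_w u w).
  by rewrite ge0_integral_pushforward //; exact: measurable_funPT.
by apply: eq_measure_integral => A mA _; exact: mp.
Qed.

(** Both squared norms equal the inner product, so the squared distance vanishes. The expansion of
    the square is arranged as an identity of sums of nonnegative terms, from which the finite
    [c + c] is cancelled. *)
Lemma ae_eq_inner_product (a b : Omega -> R) (M : R) :
  measurable_fun setT a -> measurable_fun setT b ->
  (forall w, 0 <= a w <= M)%R -> (forall w, 0 <= b w <= M)%R ->
  \int[mu]_w (a w * a w)%:E = \int[mu]_w (a w * b w)%:E ->
  \int[mu]_w (b w * b w)%:E = \int[mu]_w (a w * b w)%:E ->
  {ae mu, forall w, a w = b w}.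
Proof.
move=> ma mb aM bM aa bb.
have M0 : (0 <= M)%R by have /andP[a0] := aM point; exact: le_trans.
have a0 w : (0 <= a w)%R by have /andP[] := aM w.
have b0 w : (0 <= b w)%R by have /andP[] := bM w.
have mab : measurable_fun setT (fun w => (a w * b w)%:E).
  by apply/measurable_EFinP; exact: measurable_funM.
have maa : measurable_fun setT (fun w => (a w * a w)%:E).
  by apply/measurable_EFinP; exact: measurable_funM.
have mbb : measurable_fun setT (fun w => (b w * b w)%:E).
  by apply/measurable_EFinP; exact: measurable_funM.
have msq : measurable_fun setT (fun w => ((a w - b w) ^+ 2)%:E).
  by apply/measurable_EFinP; apply: measurable_funX; exact: measurable_funB.
have ab0 w : 0 <= (a w * b w)%:E by rewrite lee_fin mulr_ge0.
set c := \int[mu]_w (a w * b w)%:E in aa bb.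
have cfin : c \is a fin_num.
  apply: integrable_fin_num => //.
  apply: (@bounded_integrable _ _ _ mu (fun w => a w * b w)%R (M * M)%R) => //.
    exact: measurable_funM.
  move=> w; rewrite ger0_norm ?mulr_ge0 // ler_pM //.
    by have /andP[] := aM w.
  by have /andP[] := bM w.
have : \int[mu]_w ((a w - b w) ^+ 2)%:E + (c + c) = c + c.
  transitivity (\int[mu]_w ((a w * a w)%:E + (b w * b w)%:E)).
    rewrite -!ge0_integralD //.
    - apply: eq_integral => w _; rewrite -!EFinD; congr EFin; ring.
    - by move=> w _; rewrite lee_fin sqr_ge0.
    - by move=> w _; rewrite adde_ge0.
    - exact: emeasurable_funD.
  rewrite ge0_integralD ?aa ?bb // => w _; rewrite lee_fin mulr_ge0 //.
move=> /(congr1 (fun x => x - (c + c))).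
have cc : c + c \is a fin_num by rewrite fin_numD cfin.
rewrite addeK // subee // => sq0.
have [|ae0 _] := ae_eq_integral_abs mu measurableT (f := fun w => ((a w - b w) ^+ 2)%:E).
  by [].
have {}ae0 : ae_eq mu setT (fun w => ((a w - b w) ^+ 2)%:E) (cst 0).
  apply: ae0; rewrite -[RHS]sq0; apply: eq_integral => w _.
  by rewrite gee0_abs // lee_fin sqr_ge0.
apply: filterS ae0 => w /(_ I) [] /eqP; rewrite sqrf_eq0 subr_eq0.
by move=> /eqP.
Qed.

End measure_preserving_theory.

Section spreading.
Context (R : realType) (d0 d : measure_display).
Context (T : measurableType d0) (Omega : measurableType d).
Variables (mu : probability Omega R) (xi : nat -> {RV mu >-> T}).
Variable eta : nat -> {mfun Omega >-> Omega}.
Hypothesis spread : partial_spreading xi eta.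

Let mp n : measure_preserving mu (eta n). Proof. by have [] := spread. Qed.

Let theta n := iter n (eta 0%N).

Let mtheta n : measurable_fun setT (theta n).
Proof.
elim: n => [|n IH]; first exact: measurable_id.
by rewrite /theta /=; apply: measurableT_comp => //; exact: measurable_funPT.
Qed.

HB.instance Definition _ n := isMeasurableFun.Build _ _ _ _ (theta n) (mtheta n).

Let mp_theta n : measure_preserving mu (theta n).
Proof.
elim: n => [|n IH] A mA //.
rewrite -[X in mu X]/(theta n @^-1` (eta 0%N @^-1` A)) IH ?mp //.
by rewrite -[X in measurable X]setTI; exact: measurable_funPT.
Qed.

Let eta_theta k n w : (0 < k)%N -> eta k (theta n w) = theta n (eta (k + n)%N w).
Proof.
have [_ + _ _] := spread => rel.
elim: n k => [|n IH] k k0; first by rewrite addn0.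
rewrite /theta /= -/(theta n w) -/(theta n (eta (k + n.+1)%N w)).
rewrite addnS -addSn -IH //.
exact: (rel 0%N k k0 (theta n w)).
Qed.

Let xi_theta n k w : xi (n + k)%N w = xi k (theta n w).
Proof.
have [_ _ _ xiE] := spread; rewrite !xiE /= /theta addnC iterD //.
Qed.

(** [xi n] is [xi 0] after [theta n], and [eta k] passes through [theta n] as [eta (k - n)], which
    localization absorbs because [n < k]. *)
Let xi_eta n k w : (n < k)%N -> xi n (eta k w) = xi n w.
Proof.
move=> nk; have [_ _ loc _] := spread.
have := xi_theta n 0 w; rewrite addn0 => ->.
have := xi_theta n 0 (eta k w); rewrite addn0 => ->.
rewrite -[in LHS](subnK (ltnW nk)) -eta_theta ?subn_gt0 //.
by rewrite -[LHS]/((xi 0%N \o eta (k - n)%N) (theta n w)) -loc ?subn_gt0.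
Qed.

Lemma spreading_stationary : stationary xi.
Proof.
move=> n _ A mA; have mA' := measurable_path_event xi mA.
rewrite -(mp_theta n mA'); congr (mu _); apply/funext => w /=.
by congr A; apply/funext => k; rewrite xi_theta.
Qed.

Hypothesis max : sigma_rv xi [set 0%N] =
  \bigcap_(k in [set k | (1 <= k)%N]) almost_invariant mu (eta k).
Local Open Scope ereal_scope.

(* The density [u] of an event of the past given [theta n] is [eta k]-invariant
   for [0 < k], since [u \o eta k] and [u] have the same inner products with
   [u]; hence maximality makes [u] a function of [xi 0]. *)
Lemma spreading_markov_law : markov_law xi.
Proof.
move=> n q M mq q0 qM.
have mxi k : measurable_fun setT (xi k) by exact: measurable_funPT.
(* The transition is read off once, between times 0 and 1; the same [h] works for every [n]. *)
have [|||h [mh h0 hM hE]] := @conditioning _ _ _ _ _ mu (xi 0%N) (q \o xi 1%N) M.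
- exact: measurableT_comp.
- by move=> w; exact: q0.
- by move=> w; exact: qM.
exists h; split => // A mA; set B := [set w | _].
have mB : measurable B := measurable_path_event xi mA.
have B_eta k : (n < k)%N -> eta k @^-1` B = B.
  move=> nk; apply/seteqP; split => w /=; apply: (coord_dep mA) => i /= ik.
    by rewrite xi_eta // (leq_ltn_trans ik).
  by rewrite xi_eta // (leq_ltn_trans ik).
have [|||u [mu' u0 u1 uE]] := @conditioning _ _ _ _ _ mu (theta n) (\1_B) 1%R.
- exact: measurable_indic.
- by move=> w; rewrite indicE ler0n.
- by move=> w; rewrite indicE lern1 leq_b1.
(* [u] is the conditional probability of [B] given [theta n]. As [theta n] preserves [mu], the
   integral over [B] of a function of [theta n] becomes an integral over the whole space against
   [u]. *)
have thetaE (v : Omega -> R) : measurable_fun setT v -> (forall w, 0 <= v w)%R ->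
    \int[mu]_(w in B) (v (theta n w))%:E = \int[mu]_w (v w * u w)%:E.
  move=> mv v0; rewrite integral_mkcond epatch_indic.
  rewrite (uE (EFin \o v)); [|exact/measurable_EFinP|by move=> w; rewrite /= lee_fin].
  apply: (@ge0_integral_measure_preserving _ _ _ mu (theta n) (fun w => (v w * u w)%:E)).
  - exact: mp_theta.
  - by apply/measurable_EFinP; exact: measurable_funM.
  - by move=> w; rewrite lee_fin mulr_ge0.
have u_eta k : (0 < k)%N -> {ae mu, forall w, u (eta k w) = u w}.
  move=> k0; have mue : measurable_fun setT (u \o eta k).
    by apply: measurableT_comp => //; exact: measurable_funPT.
  (* Through [thetaE] both sides are integrals over [B]; there [eta k] passes [theta n] as
     [eta (k + n)], which preserves both [mu] and the event [B]. *)
  have eqI : \int[mu]_w (u (eta k w) * u w)%:E = \int[mu]_w (u w * u w)%:E.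
    apply: etrans (esym (thetaE (u \o eta k) mue (fun w => u0 _))) _.
    apply: etrans _ (thetaE u mu' u0).
    rewrite integral_mkcond [RHS]integral_mkcond.
    rewrite -[RHS](ge0_integral_measure_preserving (mp (k + n)%N)).
    - apply: eq_integral => w _; rewrite !patchE /= eta_theta //.
      have BE : B (eta (k + n)%N w) = B w.
        by rewrite -[LHS]/((eta (k + n)%N @^-1` B) w) B_eta // -{1}[n]add0n ltn_add2r.
      have [Bw|nBw] := pselect (B w); first by rewrite !mem_set // BE.
      by rewrite !memNset // BE.
    - apply/measurable_restrict => //; rewrite setIidr //; apply: measurable_funTS.
      by apply/measurable_EFinP; exact: measurableT_comp.
    - by move=> w; rewrite patchE; case: ifP => // _; rewrite lee_fin.
  apply: (@ae_eq_inner_product _ _ _ mu _ _ 1%R) => //.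
  - by move=> w; rewrite u0 u1.
  - by move=> w; rewrite u0 u1.
  - rewrite eqI; apply: (@ge0_integral_measure_preserving _ _ _ mu (eta k)
      (fun w => (u w * u w)%:E)) => //.
      by apply/measurable_EFinP; exact: measurable_funM.
    by move=> w; rewrite lee_fin mulr_ge0.
(* Preimages of Borel sets under [u] are almost invariant under every [eta k] with [k] positive, so
   maximality puts them into the completed sigma-algebra of [xi 0]. *)
have cu : is_condexp mu (completed_sigma mu (xi 0%N)) u u.
  have Lu : u \in Lfun mu +oo.
    by apply: (@Lfun_bounded _ _ _ _ _ 1%R) => // w; rewrite ger0_norm.
  apply: is_condexp_id => // D mD; rewrite -sigma_rv1E max => k /= k0.
  have muD : measurable (u @^-1` D) by rewrite -[_ @^-1` _]setTI; exact: mu'.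
  have muDe : measurable (eta k @^-1` (u @^-1` D)).
    by rewrite -[X in measurable X]setTI; exact: measurable_funPT.
  split => //; have [N [mN N0 uN]] := u_eta k k0.
  apply: (subset_measure0 _ mN _ N0).
    by apply: measurableU; exact: measurableD.
  move=> w wD; apply: uN => /= uw; move: wD.
  by rewrite /setY /setD /= uw => -[[]|[]].
have Lu : u \in Lfun mu +oo by case: cu.
have [v [K [mv vK cv]]] := condexp_exists (xi 0%N) Lu.
(* The function given by [condexp_exists] may take negative values where it differs from [u];
   clipping at 0 makes it admissible in [hE]. *)
pose v0 t : R := Num.max (v t) 0%R.
have v00 t : (0 <= v0 t)%R by rewrite le_max lexx orbT.
have mv0 : measurable_fun setT v0 by exact: measurable_maxr.
have uv : {ae mu, forall w, v0 (xi 0%N w) = u w}.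
  have := is_condexp_unique (completed_sigma_algebra mu (xi 0%N))
    (@completed_sigma_sub _ _ _ _ _ mu _) cu cv.
  by apply: filterS => w uw; rewrite /v0 -[v _]uw; exact/max_idPl.
have replace (g : T -> R) k : measurable_fun setT g -> (forall t, 0 <= g t)%R ->
    \int[mu]_w (g (xi k w) * u w)%:E =
    \int[mu]_w ((v0 (xi 0%N w))%:E * (g (xi k w))%:E).
  move=> mg g0; apply: ae_eq_integral => //.
  - apply/measurable_EFinP; apply: measurable_funM => //.
    exact: measurableT_comp.
  - by apply: emeasurable_funM; apply/measurable_EFinP; exact: measurableT_comp.
  - by apply: filterS uv => w -> _; rewrite -EFinM mulrC.
have xiS w : xi n.+1 w = xi 1%N (theta n w) by rewrite -xi_theta addn1.
have xi0 w : xi n w = xi 0%N (theta n w) by rewrite -xi_theta addn0.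
under eq_integral do rewrite xiS; under [RHS]eq_integral do rewrite xi0.
rewrite (thetaE (q \o xi 1%N)); [|exact: measurableT_comp|by move=> w; exact: q0].
rewrite (thetaE (h \o xi 0%N)); [|exact: measurableT_comp|by move=> w; exact: h0].
rewrite [LHS](replace q) // [RHS](replace h) //.
apply: (hE (EFin \o v0)); first exact/measurable_EFinP.
by move=> t; rewrite /= lee_fin.
Qed.

End spreading.

(** * Laws of sequences, determined by rectangles and, for Markov sequences, by pairs *)

Lemma pi_system_unique (R : realType) d (S : measurableType d)
    (G : set (set S)) (m1 m2 : {measure set S -> \bar R}) :
  measurable = <<s G >> -> setI_closed G -> G setT ->
  (m1 setT < +oo)%E -> (forall A, G A -> m1 A = m2 A) ->
  forall A, measurable A -> m1 A = m2 A.
Proof.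
by move=> SG GI GT fin m12 A; apply: (measure_unique G (fun=> setT)) => //;
  rewrite bigcup_const.
Qed.

Section rectangles.
Context (d : measure_display) (T : measurableType d).

Definition rectangle n (B : nat -> set T) : set (nat -> T) :=
  [set x | forall i, (i <= n)%N -> B i (x i)].

Definition rectangles n : set (set (nat -> T)) :=
  [set A | exists2 B : nat -> set T, forall i, measurable (B i) & A = rectangle n B].

Lemma rectangle_sigma n B : (forall i, measurable (B i)) ->
  <<s coord_gen T [set i | (i <= n)%N] >> (rectangle n B).
Proof.
move=> mB.
rewrite (_ : rectangle n B =
  \bigcap_(i in [set i | (i <= n)%N]) ((fun x : nat -> T => x i) @^-1` B i)) //.
apply: (@bigcap_measurable _ (coord_space T [set i | (i <= n)%N])).
  by exists 0%N.
move=> i /= ni; rewrite -[X in measurable X]setTI.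
exact: measurable_coord_proj.
Qed.

Lemma sigma_rectangles n :
  <<s coord_gen T [set i | (i <= n)%N] >> = <<s rectangles n >>.
Proof.
apply/seteqP; split.
  apply: smallest_sub; first exact: smallest_sigma_algebra.
  move=> _ [i /= ni [B mB <-]]; apply: sub_sigma_algebra.
  exists (fun j => if j == i then B else setT).
    by move=> j; case: ifP.
  apply/seteqP; split => x /=.
    by move=> [_ Bx] j nj; case: eqP => // ->.
  by move=> /(_ i ni); rewrite eqxx.
apply: smallest_sub; first exact: smallest_sigma_algebra.
by move=> _ [B mB ->]; exact: rectangle_sigma.
Qed.

Lemma rectangles_setI n : setI_closed (rectangles n).
Proof.
move=> _ _ [B mB ->] [B' mB' ->]; exists (fun i => B i `&` B' i).
  by move=> i; exact: measurableI.
apply/seteqP; split => x /=.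
  by move=> [Bx B'x] i ni; split; [exact: Bx|exact: B'x].
by move=> BB'; split => i ni; have [] := BB' i ni.
Qed.

Lemma rectangles_setT n : rectangles n setT.
Proof. by exists (fun=> setT) => //; apply/seteqP; split. Qed.

End rectangles.
Arguments rectangles {d} T n.

Section same_law_transfer.
Context (R : realType) (d0 d1 d2 : measure_display) (T : measurableType d0).
Context (O1 : measurableType d1) (O2 : measurableType d2).
Variables (P1 : probability O1 R) (X1 : nat -> {RV P1 >-> T}).
Variables (P2 : probability O2 R) (X2 : nat -> {RV P2 >-> T}).
Local Open Scope ereal_scope.

Definition same_law_on (I : set nat) := forall A, <<s coord_gen T I >> A ->
  P1 [set w | A (fun n => X1 n w)] = P2 [set w | A (fun n => X2 n w)].

Lemma same_law_integral I A (u : coord_space T I -> \bar R) : same_law_on I ->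
  <<s coord_gen T I >> A -> measurable_fun setT u -> (forall x, 0 <= u x) ->
  \int[P1]_(w in [set w | A (fun n => X1 n w)]) u (fun n => X1 n w) =
  \int[P2]_(w in [set w | A (fun n => X2 n w)]) u (fun n => X2 n w).
Proof.
move=> law mA mu' u0.
have E d (O : measurableType d) (P : probability O R) (X : nat -> {RV P >-> T}) :
    \int[P]_(w in [set w | A (fun n => X n w)]) u (fun n => X n w) =
    \int[pushforward P (path_map X I)]_(x in A) u x.
  by rewrite ge0_integral_pushforward //; exact: measurable_funTS.
rewrite !E; apply: eq_measure_integral => B mB _; exact: law.
Qed.

Lemma same_law_rectangles n :
  (forall B, (forall i, measurable (B i)) ->
    P1 [set w | forall i, (i <= n)%N -> B i (X1 i w)] =
    P2 [set w | forall i, (i <= n)%N -> B i (X2 i w)]) ->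
  same_law_on [set i | (i <= n)%N].
Proof.
move=> rectE A mA.
pose I := [set i | (i <= n)%N].
pose m1 : {measure set (coord_space T I) -> \bar R} :=
  distribution P1 (path_map X1 I : {RV P1 >-> coord_space T I}).
pose m2 : {measure set (coord_space T I) -> \bar R} :=
  distribution P2 (path_map X2 I : {RV P2 >-> coord_space T I}).
change (m1 A = m2 A).
refine (@pi_system_unique _ _ (coord_space T I) (rectangles T n)
  m1 m2 _ _ _ _ _ A mA) => //.
- by rewrite -sigma_rectangles.
- exact: rectangles_setI.
- exact: rectangles_setT.
- by rewrite /m1 /= probability_setT ltry.
by move=> _ [B mB ->]; exact: rectE.
Qed.

Lemma same_law_all : (forall n, same_law_on [set i | (i <= n)%N]) ->
  same_law X1 X2.
Proof.
move=> law A mA; pose G := \bigcup_n rectangles T n.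
pose m1 : {measure set (coord_space T [set: nat]) -> \bar R} :=
  distribution P1 (path_map X1 setT : {RV P1 >-> coord_space T setT}).
pose m2 : {measure set (coord_space T [set: nat]) -> \bar R} :=
  distribution P2 (path_map X2 setT : {RV P2 >-> coord_space T setT}).
change (m1 A = m2 A).
refine (@pi_system_unique _ _ (coord_space T [set: nat]) G
  m1 m2 _ _ _ _ _ A mA) => //.
- apply/seteqP; split; apply: smallest_sub; do ?exact: smallest_sigma_algebra.
    move=> _ [i _ [B mB <-]].
    have sub : <<s rectangles T i >> `<=` <<s G >>.
      by apply: sub_sigma_algebra2 => C; exists i.
    apply: sub; rewrite -sigma_rectangles; apply: sub_sigma_algebra; exists i => //=.
    by exists B.
  move=> C [n _ Cn]; apply: (@coord_gen_sub _ _ _ [set i | (i <= n)%N]) => //.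
  by rewrite sigma_rectangles; exact: sub_sigma_algebra.
- move=> A1 A2 [n _ A1n] [m _ A2m]; exists (maxn n m) => //.
  (* Padding with [setT] brings two rectangles to a common length, so that the union over all
     lengths is closed under intersection. *)
  have H k l C : (k <= l)%N -> rectangles T k C -> rectangles T l C.
    move=> kl [B mB ->]; exists (fun i => if (i <= k)%N then B i else setT).
      by move=> i; case: ifP.
    apply/seteqP; split => x /= Bx i il.
      by case: ifP => // ik; exact: Bx.
    by have := Bx i (leq_trans il kl); rewrite il.
  by apply: rectangles_setI; [apply: H A1n; exact: leq_maxl|apply: H A2m; exact: leq_maxr].
- by exists 0%N => //; exact: rectangles_setT.
- by rewrite /m1 /= probability_setT ltry.
move=> C [n _ [B mB ->]]; apply: (law n); exact: rectangle_sigma.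
Qed.

Lemma same_law_stationary : same_law X1 X2 -> stationary X2 -> stationary X1.
Proof.
move=> law st n n1 A mA; rewrite (law _ mA) (st n n1 _ mA).
apply/esym; apply: (law [set x | A (fun k => x (n + k)%N)]).
rewrite -[X in cylinder_sigma X]setTI.
have ms : measurable_fun setT ((fun x k => x (n + k)%N) :
    coord_space T [set: nat] -> coord_space T [set: nat]).
  by apply: measurable_coord_fun => i _; exact: measurable_coord_proj.
exact: (ms measurableT _ mA).
Qed.

(** Both sides of the Markov identity are integrals of path functionals, so the transition [h] of
    [X2] also serves [X1]. *)
Lemma same_law_markov : same_law X1 X2 -> markov_law X2 -> markov_law X1.
Proof.
move=> law Mk n q M mq q0 qM; have [h [mh h0 hM hE]] := Mk n q M mq q0 qM.
exists h; split => // A mA.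
have mA' : <<s coord_gen T [set: nat] >> A by exact: coord_gen_sub mA.
rewrite (@same_law_integral setT A (fun x => (q (x n.+1))%:E)) //; first last.
- by move=> x; rewrite lee_fin.
- apply/measurable_EFinP; apply: measurableT_comp => //.
  exact: measurable_coord_proj.
rewrite hE // (@same_law_integral setT A (fun x => (h (x n))%:E)) //; first last.
- by move=> x; rewrite lee_fin.
- apply/measurable_EFinP; apply: measurableT_comp => //.
  exact: measurable_coord_proj.
Qed.

End same_law_transfer.

Section markov_transition.
Context (R : realType) (d0 d : measure_display).
Context (T : measurableType d0) (Omega : measurableType d).
Variables (P : probability Omega R) (X : nat -> {RV P >-> T}).
Local Open Scope ereal_scope.

Lemma integral_event_indic (A : set Omega) (Y : {mfun Omega >-> T}) B :
  measurable A -> measurable B ->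
  \int[P]_(w in A) (\1_B (Y w))%:E = P [set w | A w /\ B (Y w)].
Proof.
move=> mA mB; have mYB : measurable (Y @^-1` B).
  by rewrite -[_ @^-1` _]setTI; exact: measurable_funPT.
transitivity (\int[P]_(w in A) (\1_(Y @^-1` B) w)%:E) => //.
rewrite integral_indic //; congr (P _).
by apply/seteqP; split => w /= [].
Qed.

Lemma stationary_pair n C B : stationary X -> measurable C -> measurable B ->
  P [set w | C (X n w) /\ B (X n.+1 w)] = P [set w | C (X 0%N w) /\ B (X 1%N w)].
Proof.
move=> st mC mB; case: n => [//|n].
have := st n.+1 isT [set x | C (x 0%N) /\ B (x 1%N)].
rewrite /= addn0 addn1 => ->//.
apply: (@measurableI _ (coord_space T [set: nat]) [set x | C (x 0%N)] [set x | B (x 1%N)]).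
  rewrite -[X in measurable X]setTI.
  by apply: (@measurable_coord_proj _ _ T [set: nat] 0%N).
rewrite -[X in measurable X]setTI.
by apply: (@measurable_coord_proj _ _ T [set: nat] 1%N).
Qed.

End markov_transition.

(** By induction on the number of coordinates: the transition to the last coordinate turns the
    probability of a rectangle into an integral over a shorter one. The transitions [h1] and [h2]
    are chosen independently, but the pair laws force them to agree almost everywhere for the common
    law at time [n]. *)
Lemma markov_law_unique (R : realType) (d0 d1 d2 : measure_display)
    (T : measurableType d0) (O1 : measurableType d1) (O2 : measurableType d2)
    (P1 : probability O1 R) (X1 : nat -> {RV P1 >-> T})
    (P2 : probability O2 R) (X2 : nat -> {RV P2 >-> T}) :
  stationary X1 -> stationary X2 -> markov_law X1 -> markov_law X2 ->
  (forall C B, measurable C -> measurable B ->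
    P1 [set w | C (X1 0%N w) /\ B (X1 1%N w)] =
    P2 [set w | C (X2 0%N w) /\ B (X2 1%N w)]) ->
  same_law X1 X2.
Proof.
move=> st1 st2 M1 M2 pair; apply: same_law_all.
elim=> [|n IH].
  apply: same_law_rectangles => B mB.
  have E d (O : measurableType d) (P : probability O R) (X : nat -> {RV P >-> T}) :
      [set w | forall i, (i <= 0)%N -> B i (X i w)] =
      [set w | B 0%N (X 0%N w) /\ setT (X 1%N w)].
    apply/seteqP; split => w /= => [H|[B0 _] i]; first by split => //; exact: H.
    by rewrite leqn0 => /eqP ->.
  by rewrite !E; exact: pair.
apply: same_law_rectangles => B mB.
pose A := rectangle n B.
have mA : <<s coord_gen T [set i | (i <= n)%N] >> A by exact: rectangle_sigma.
have mq : measurable_fun setT (\1_(B n.+1) : T -> R) by exact: measurable_indic.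
have [||h1 [mh1 h10 h1M h1E]] := M1 n _ 1 mq.
- by move=> t; rewrite indicE ler0n.
- by move=> t; rewrite indicE lern1 leq_b1.
have [||h2 [mh2 h20 h2M h2E]] := M2 n _ 1 mq.
- by move=> t; rewrite indicE ler0n.
- by move=> t; rewrite indicE lern1 leq_b1.
have E d (O : measurableType d) (P : probability O R) (X : nat -> {RV P >-> T}) :
    P [set w | forall i, (i <= n.+1)%N -> B i (X i w)] =
    (\int[P]_(w in [set w | A (fun k => X k w)]) (\1_(B n.+1) (X n.+1 w))%:E)%E.
  rewrite integral_event_indic //; last exact: measurable_path_event mA.
  congr (P _); apply/seteqP; split => w /=.
    by move=> H; split; [move=> i ni; apply: H; exact: leqW|exact: H].
  move=> [Aw Bw] i; rewrite leq_eqVlt => /orP[/eqP -> //|].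
  by rewrite ltnS; exact: Aw.
rewrite !E h1E // h2E //.
have transfer C : <<s coord_gen T [set i | (i <= n)%N] >> C ->
    (\int[P1]_(w in [set w | C (fun k => X1 k w)]) (h1 (X1 n w))%:E =
     \int[P2]_(w in [set w | C (fun k => X2 k w)]) (h1 (X2 n w))%:E)%E.
  move=> mC.
  apply: (same_law_integral (u := fun x => (h1 (x n))%:E) IH mC) => //.
    apply/measurable_EFinP; apply: measurableT_comp => //.
    by apply: measurable_coord_proj => /=.
  by move=> x; rewrite lee_fin.
rewrite transfer //.
have mX2 : measurable_fun setT (X2 n) by exact: measurable_funPT.
pose pi : probability T R := distribution P2 (X2 n).
have mcoord C : measurable C ->
    <<s coord_gen T [set i | (i <= n)%N] >> [set x | C (x n)].
  move=> mC; apply: sub_sigma_algebra; exists n => //=; exists C => //.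
  by rewrite setTI.
have h12 : ae_eq pi setT (EFin \o h1) (EFin \o h2).
  have If : pi.-integrable setT (EFin \o h1).
    by apply: (@bounded_integrable _ _ _ pi h1 1) => // t; rewrite ger0_norm.
  apply: integral_ae_eq => //; first exact/measurable_EFinP.
  move=> C _ mC.
  have EC (h : T -> R) : measurable_fun setT h -> (forall t, 0 <= h t) ->
      (\int[pi]_(x in C) (EFin \o h) x =
      \int[P2]_(w in [set w | C (X2 n w)]) (h (X2 n w))%:E)%E.
    move=> mh h0; rewrite /pi ge0_integral_pushforward //.
      by apply: measurable_funTS; exact/measurable_EFinP.
    by move=> t _; rewrite /= lee_fin.
  rewrite !EC // -(transfer _ (mcoord _ mC)).
  rewrite -(h1E _ (mcoord _ mC)) -(h2E _ (mcoord _ mC)).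
  rewrite !integral_event_indic //.
  - apply: etrans (stationary_pair n st1 mC (mB n.+1)) _.
    by apply: etrans _ (esym (stationary_pair n st2 mC (mB n.+1))); exact: pair.
  - exact: (measurable_path_event X2 (mcoord _ mC)).
  - exact: (measurable_path_event X1 (mcoord _ mC)).
have mA2 := measurable_path_event X2 mA.
apply: ae_eq_integral => //.
- by apply: measurable_funTS; apply/measurable_EFinP; exact: measurableT_comp.
- by apply: measurable_funTS; apply/measurable_EFinP; exact: measurableT_comp.
have [N [mN N0 hN]] := h12.
exists (X2 n @^-1` N); split => //.
  by rewrite -[X in measurable X]setTI; exact: mX2.
move=> w /= ne; apply: hN => /= eq; apply: ne => _.
exact: eq.
Qed.

(** * Digit expansions in bases 2 and 3 *)

Section digits.
Context (R : realType).
(* Base 2 turns a uniform variable into fair coins. Base 3, with digits 0 and 2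
   only, is an injective coding of bit sequences, which base 2 is not. *)
Variable beta : R.
Hypothesis beta_ge2 : 2 <= beta.

(** Iterates an expanding map, the bit being read off by comparison with 1/2. In base 2 it is the
    doubling map modulo 1 on [[0, 1)]; in base 3 the threshold is the midpoint of the removed Cantor
    interval and separates digit 0 from digit 2. *)
Fixpoint orbit (t : R) (n : nat) : R :=
  if n is m.+1 then beta * orbit t m - (beta - 1) *+ (2^-1 <= orbit t m)%R
  else t.

Definition digit (t : R) (n : nat) : bool := 2^-1 <= orbit t n.

Definition partial_expansion (b : nat -> bool) (n : nat) : R :=
  \sum_(i < n) (beta - 1) *+ b i / beta ^+ i.+1.

Definition expansion (b : nat -> bool) : R := limn (partial_expansion b).

Let beta0 : 0 < beta. Proof. by rewrite (lt_le_trans _ beta_ge2). Qed.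
Let beta1 : 0 <= beta - 1.
Proof. by rewrite subr_ge0 (le_trans _ beta_ge2) // ler1n. Qed.

Lemma partial_expansionS b n :
  partial_expansion b n.+1 =
    ((beta - 1) *+ b 0%N + partial_expansion (b \o S) n) / beta.
Proof.
rewrite /partial_expansion big_ord_recl expr1 mulrDl; congr (_ + _).
rewrite big_distrl /=; apply: eq_bigr => i _.
by rewrite /bump /= add1n (exprS _ i.+1) invfM mulrA mulrAC.
Qed.

Lemma partial_expansion_orbit t n :
  t = partial_expansion (digit t) n + orbit t n / beta ^+ n.
Proof.
elim: n => [|n IH]; first by rewrite /partial_expansion big_ord0 add0r expr0 divr1.
rewrite /partial_expansion big_ord_recr /= -/(partial_expansion (digit t) n).
rewrite {1}IH -addrA; congr (_ + _).
rewrite -/(digit t n) -mulrDl addrC subrK exprS invfM mulrA.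
by rewrite [beta * _]mulrC mulfK // gt_eqF.
Qed.

Lemma partial_expansion_ge0 b n : 0 <= partial_expansion b n.
Proof.
apply: sumr_ge0 => i _; rewrite divr_ge0 ?exprn_ge0 ?(ltW beta0) //.
by rewrite mulrn_wge0.
Qed.

(** The term [(beta ^+ n)^-1] is the largest possible tail; carrying it along makes the induction
    close, each digit being at most [beta - 1]. *)
Lemma partial_expansion_le b n : partial_expansion b n + (beta ^+ n)^-1 <= 1.
Proof.
elim: n b => [|n IH] b; first by rewrite /partial_expansion big_ord0 add0r expr0 invr1.
rewrite partial_expansionS exprS invfM mulrC -mulrDr.
rewrite mulrC ler_pdivrMr // mul1r -addrA.
apply: (@le_trans _ _ ((beta - 1) + 1)); last by rewrite subrK.
by apply: lerD; [case: (b 0%N); rewrite ?mulr0n|exact: IH].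
Qed.

Lemma is_cvg_partial_expansion b : cvgn (partial_expansion b).
Proof.
apply: nondecreasing_is_cvgn.
  apply/nondecreasing_seqP => n; rewrite /partial_expansion big_ord_recr /= lerDl.
  by rewrite divr_ge0 ?exprn_ge0 ?(ltW beta0) // mulrn_wge0.
exists 1 => _ [n _ <-]; apply: le_trans (partial_expansion_le b n).
by rewrite lerDl invr_ge0 exprn_ge0 // ltW.
Qed.

Lemma expansion_ge0 b : 0 <= expansion b.
Proof.
apply: limr_ge; first exact: is_cvg_partial_expansion.
by apply: nearW => n; exact: partial_expansion_ge0.
Qed.

Lemma expansion_le1 b : expansion b <= 1.
Proof.
apply: limr_le; first exact: is_cvg_partial_expansion.
apply: nearW => n; apply: le_trans (partial_expansion_le b n).
by rewrite lerDl invr_ge0 exprn_ge0 // ltW.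
Qed.

Lemma expansionE b :
  expansion b = ((beta - 1) *+ b 0%N + expansion (b \o S)) / beta.
Proof.
apply/cvg_lim => //; rewrite -cvg_shiftS /=.
under eq_fun do rewrite partial_expansionS.
apply: cvgMl; apply: cvgD; first exact: cvg_cst.
exact: is_cvg_partial_expansion.
Qed.

Lemma orbit_shift t n : orbit t n.+1 = orbit (orbit t 1) n.
Proof. by elim: n => [//|n IH]; rewrite [LHS]/= -/(orbit t n.+1) IH. Qed.

(** A leading 0 leaves a value of at most [1 / beta], below the threshold 1/2 because [2 < beta],
    while a leading 1 gives at least [(beta - 1) / beta], above it. So the first bit is recovered,
    and one step of [orbit] yields the expansion of the remaining bits. *)
Lemma expansion_digitK : 2 < beta -> cancel expansion digit.
Proof.
move=> beta2 b; apply/funext => n.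
have dig0 c : digit (expansion c) 0 = c 0%N.
  rewrite /digit /= expansionE; case: (c 0%N); rewrite ?mulr1n ?mulr0n.
    rewrite ler_pdivlMr // mulrC ler_pdivrMr //.
    have := expansion_ge0 (c \o S); nra.
  apply/negbTE; rewrite -ltNge add0r ltr_pdivrMr // mulrC.
  have := expansion_le1 (c \o S); nra.
elim: n b => [|n IH] b; first exact: dig0.
rewrite /digit orbit_shift -/(digit _ _) [orbit _ 1]/= -/(digit (expansion b) 0) dig0.
rewrite {1}expansionE mulrC divfK ?gt_eqF // addrAC subrr add0r.
exact: IH.
Qed.

Lemma measurable_orbit n : measurable_fun setT (orbit ^~ n).
Proof.
elim: n => [|n IH] /=; first exact: measurable_id.
apply: measurable_funB; first exact: measurable_funM.
rewrite (_ : (fun _ => _) = fun t => if 2^-1 <= orbit t n then beta - 1 else 0).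
  by apply: measurable_fun_ifT => //; exact: measurable_fun_ler.
by apply/funext => t; case: ifP.
Qed.

Lemma measurable_digit n : measurable_fun setT (digit ^~ n).
Proof. by apply: measurable_fun_ler => //; exact: measurable_orbit. Qed.

Lemma measurable_expansion :
  measurable_fun setT (expansion : coord_space bool [set: nat] -> R).
Proof.
apply: (@measurable_fun_cvg _ (coord_space bool [set: nat]) R setT
  (fun n b => partial_expansion b n)) => [n|b _].
  apply: measurable_sum => i; apply: measurable_funM => //.
  rewrite (_ : (fun _ => _) = fun b => if b (val i) then beta - 1 else 0).
    by apply: measurable_fun_ifT => //; exact: measurable_coord_proj.
  by apply/funext => b; case: (b i).
exact: is_cvg_partial_expansion.
Qed.

End digits.

Section binary.
Context (R : realType).

Lemma binary_orbit (t : R) n : 0 <= t < 1 -> 0 <= orbit 2 t n < 1.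
Proof.
move=> t01; elim: n => [//|n IH] /=.
by case: (lerP 2^-1 (orbit 2 t n)) => /= ?; lra.
Qed.

Lemma binary_expansionK (t : R) : 0 <= t < 1 -> expansion 2 (digit 2 t) = t.
Proof.
move=> t01; apply/cvg_lim => //.
apply: (@squeeze_cvgr _ _ _ _ (fun n => t - 2^-1 ^+ n) (fun=> t)).
- apply: nearW => n; have /andP[p0 p1] := binary_orbit n t01.
  have tE := partial_expansion_orbit (lexx 2) t n; rewrite exprVn.
  set z := 2 ^+ n in tE *; have z0 : 0 < z by rewrite exprn_gt0.
  have D0 : 0 <= orbit 2 t n / z by rewrite divr_ge0 // ltW.
  have D1 : orbit 2 t n / z <= z^-1.
    by rewrite ler_pdivrMr // mulVf ?gt_eqF // ltW.
  by apply/andP; split; lra.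
- rewrite -[X in _ --> X]subr0; apply: cvgB; first exact: cvg_cst.
  by apply: cvg_expr; rewrite ger0_norm ?invr_ge0 // invf_lt1 // ltr1n.
- exact: cvg_cst.
Qed.

(** By induction: the next bit halves the dyadic interval and takes the right half exactly when it
    is 1. Half-open intervals settle the dyadic endpoints. *)
Lemma binary_cylinder (t : R) (c : nat -> bool) n : 0 <= t < 1 ->
  (forall i, (i < n)%N -> digit 2 t i = c i) <->
  partial_expansion 2 c n <= t < partial_expansion 2 c n + (2 ^+ n)^-1.
Proof.
move=> t01.
have z0 m : 0 < (2 : R) ^+ m by rewrite exprn_gt0.
split=> [tc|].
  have -> : partial_expansion 2 c n = partial_expansion 2 (digit 2 t) n :> R.
    by apply: eq_bigr => i _; rewrite tc.
  have /andP[p0 p1] := binary_orbit n t01.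
  have tE := partial_expansion_orbit (lexx 2) t n.
  have D0 : 0 <= orbit 2 t n / 2 ^+ n by rewrite divr_ge0 // ltW.
  have D1 : orbit 2 t n / 2 ^+ n < (2 ^+ n)^-1.
    by rewrite ltr_pdivrMr // mulVf ?gt_eqF.
  by apply/andP; split; lra.
elim: n => [|n IH] H i; first by rewrite ltn0.
have SE : partial_expansion 2 c n.+1 =
    partial_expansion 2 c n + (c n)%:R / 2 / 2 ^+ n :> R.
  rewrite /partial_expansion big_ord_recr /=; congr (_ + _).
  by rewrite exprS invfM mulrA (_ : 2 - 1 = 1 :> R) //; ring.
have w0 : 0 < (2 ^+ n)^-1 :> R by rewrite invr_gt0.
have wS : (2 ^+ n.+1)^-1 = 2^-1 * (2 ^+ n)^-1 :> R by rewrite exprS invfM.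
have Hn : partial_expansion 2 c n <= t < partial_expansion 2 c n + (2 ^+ n)^-1.
  by move: H; rewrite SE wS; case: (c n) => /=; lra.
rewrite ltnS leq_eqVlt => /orP[/eqP ->|]; last exact: IH.
have tc := IH Hn.
have PE : partial_expansion 2 c n = partial_expansion 2 (digit 2 t) n :> R.
  by apply: eq_bigr => j _; rewrite tc.
have := partial_expansion_orbit (lexx 2) t n; rewrite -PE => tE.
rewrite /digit; move: H; rewrite SE wS {1 2}tE //.
have -> : 2 ^+ n = ((2 ^+ n)^-1)^-1 :> R by rewrite invrK.
move: w0; set w := (2 ^+ n)^-1; rewrite invrK => w0.
case: (c n) => /= /andP[h1 h2]; [|apply/negbTE; rewrite -ltNge]; nra.
Qed.

End binary.

(** * Fair coins: uniqueness, reindexing and independence *)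

Notation coin_space J := (coord_space bool [set: J]).

Section coin_theory.
Context (R : realType) (J : eqType).

Definition cylinder (s : seq (J * bool)) : set (J -> bool) :=
  [set b | all (fun p => b p.1 == p.2) s].

(** Distinct positions are required because a repeated constraint would be counted twice by [size],
    and a contradictory one empties the cylinder. *)
Definition fair (m : set (coin_space J) -> \bar R) := forall s,
  uniq (unzip1 s) -> m (cylinder s) = ((2^-1) ^+ size s)%:E.

(** A repeated constraint is dropped, a contradictory one empties the set. This links the family of
    all cylinders, closed under intersection, to the lists without repetition seen by [fair]. *)
Lemma cylinder_uniq s : cylinder s = set0 \/
  exists2 s', uniq (unzip1 s') & cylinder s = cylinder s'.
Proof.
elim: s => [|p s [IH|[s' us' IH]]]; first by right; exists [::].
  left; apply/seteqP; split => // b /= /andP[_ sb].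
  by have : cylinder s b by []; rewrite IH.
have cE b : cylinder (p :: s) b = (b p.1 == p.2 /\ cylinder s' b) :> Prop.
  rewrite -IH /cylinder /=; apply/propext; split => [/andP[]|[? ?]] //.
  exact/andP.
have [ps'|ps'] := boolP (p.1 \in unzip1 s'); last first.
  right; exists (p :: s'); first by rewrite /= ps'.
  apply/seteqP; split => b; rewrite cE /cylinder /=.
    by move=> [? ?]; apply/andP.
  by move=> /andP.
have [pin|pnin] := boolP (p \in s').
  right; exists s' => //; apply/seteqP; split => b; rewrite cE; first by case.
  by move=> sb; split => //; move/allP : sb => /(_ _ pin).
left; apply/seteqP; split => // b; rewrite cE => -[/eqP bp sb].
move/mapP : ps' => [q qs' pq]; move/allP : sb => /(_ _ qs') /= /eqP.
rewrite -pq bp => p2; move: pnin; rewrite (_ : p = q) ?qs' //.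
by case: p q pq p2 {qs' bp cE} => [? ?] [? ?] /= -> ->.
Qed.

Lemma measurable_cylinder s : measurable (cylinder s : set (coin_space J)).
Proof.
elim: s => [|p s IH].
  by rewrite (_ : cylinder _ = setT) //; apply/seteqP; split.
rewrite (_ : cylinder _ = [set b | b p.1 == p.2] `&` cylinder s).
  apply: measurableI => //.
  rewrite (_ : [set b | _] = (fun b : coin_space J => b p.1) @^-1` [set p.2]).
    rewrite -[X in measurable X]setTI.
    exact: (@measurable_coord_proj _ _ bool [set: J] p.1).
  by apply/seteqP; split => b /= /eqP.
by apply/seteqP; split => b /=; [move=> /andP|move=> [? ?]; apply/andP].
Qed.

Lemma cylinders_sigma : @measurable _ (coin_space J) = <<s range cylinder >>.
Proof.
apply/seteqP; split; apply: smallest_sub; do ?exact: smallest_sigma_algebra.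
  move=> _ [j _ [B _ <-]].
  pose FT : measurableType _ := g_sigma_algebraType (range cylinder).
  have mj c : measurable ([set b | b j == c] : set FT).
    apply: sub_sigma_algebra; exists [:: (j, c)] => //.
    by apply/seteqP; split => b; rewrite /cylinder /= andbT.
  rewrite setTI (_ : _ @^-1` B = \bigcup_(c in B) [set b | b j == c]).
    apply: (@fin_bigcup_measurable _ FT) => //.
    apply: (@sub_finite_set _ _ [set true; false]); last exact: finite_set2.
    by move=> [] _ /=; [left|right].
  apply/seteqP; split => b /=; first by move=> Bb; exists (b j) => /=.
  by move=> [c Bc /eqP ->].
by move=> _ [s _ <-]; exact: measurable_cylinder.
Qed.

Lemma cylinders_setI : setI_closed (range cylinder).
Proof.
move=> _ _ [s _ <-] [s' _ <-]; exists (s ++ s') => //.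
apply/seteqP; split => b; rewrite /cylinder /= all_cat.
  by move=> /andP.
by move=> [? ?]; apply/andP.
Qed.

Lemma cylinder_nil : cylinder [::] = setT.
Proof. by apply/seteqP; split. Qed.

Lemma coin_measure_unique (m1 m2 : {measure set (coin_space J) -> \bar R}) :
  (m1 setT < +oo)%E ->
  (forall s, uniq (unzip1 s) -> m1 (cylinder s) = m2 (cylinder s)) ->
  forall A, measurable A -> m1 A = m2 A.
Proof.
move=> fin m12; apply: pi_system_unique cylinders_sigma _ _ fin _.
- exact: cylinders_setI.
- by exists [::] => //; exact: cylinder_nil.
move=> _ [s _ <-]; have [->|[s' us' ->]] := cylinder_uniq s.
  by rewrite !measure0.
exact: m12.
Qed.

Lemma fair_unique (m1 m2 : {measure set (coin_space J) -> \bar R}) :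
  fair m1 -> fair m2 -> forall A, measurable A -> m1 A = m2 A.
Proof.
move=> f1 f2; apply: coin_measure_unique => [|s us]; last by rewrite f1 // f2.
by rewrite -cylinder_nil f1 // ltry.
Qed.

End coin_theory.

Section reindexing.
Context (J J1 : eqType).

Definition reindex (g : J1 -> J) (b : J -> bool) : J1 -> bool := b \o g.

Lemma measurable_reindex (g : J1 -> J) :
  measurable_fun setT (reindex g : coin_space J -> coin_space J1).
Proof.
by apply: measurable_coord_fun => i _; exact: measurable_coord_proj.
Qed.

Lemma reindex_cylinder (g : J1 -> J) s :
  reindex g @^-1` cylinder s = cylinder [seq (g p.1, p.2) | p <- s].
Proof.
by apply/seteqP; split => b; rewrite /cylinder /preimage /reindex /= all_map.
Qed.

Lemma unzip1_reindex (g : J1 -> J) (s : seq (J1 * bool)) :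
  unzip1 [seq (g p.1, p.2) | p <- s] = map g (unzip1 s).
Proof. by rewrite /unzip1 -!map_comp. Qed.

End reindexing.

Section fair_reindexing.
Context (R : realType) (J J1 J2 : eqType).

(** The preimage of a cylinder is a cylinder with as many constraints, at positions that stay
    distinct because [g] is injective. *)
Lemma fair_reindex (m : {measure set (coin_space J) -> \bar R})
    (m1 : {measure set (coin_space J1) -> \bar R}) (g : J1 -> J) :
  injective g -> fair m -> fair m1 ->
  forall A : set (coin_space J1), measurable A -> m (reindex g @^-1` A) = m1 A.
Proof.
move=> ig fm fm1 A mA.
have [m2 m2E] : exists m2 : {measure set (coin_space J1) -> \bar R},
    forall B, m2 B = m (reindex g @^-1` B).
  by unshelve eexists (pushforward m (reindex g : coin_space J -> coin_space J1));
    [exact: measurable_reindex|].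
rewrite -m2E; apply: fair_unique => // s us; rewrite m2E reindex_cylinder.
by rewrite fm ?size_map // unzip1_reindex map_inj_uniq.
Qed.

(** Coins read at disjoint sets of positions are independent. For two cylinders the lists of
    constraints are concatenated; uniqueness of measures then frees first [B] and afterwards [A]. *)
Lemma fair_split (m : {measure set (coin_space J) -> \bar R})
    (m1 : {measure set (coin_space J1) -> \bar R})
    (m2 : {measure set (coin_space J2) -> \bar R}) (g1 : J1 -> J) (g2 : J2 -> J) :
  injective g1 -> injective g2 -> (forall i j, g1 i != g2 j) ->
  fair m -> fair m1 -> fair m2 ->
  forall (A : set (coin_space J1)) (B : set (coin_space J2)),
    measurable A -> measurable B ->
    m (reindex g1 @^-1` A `&` reindex g2 @^-1` B) = (m1 A * m2 B)%E.
Proof.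
move=> ig1 ig2 g12 fm fm1 fm2.
have pre (m' : {measure set (coin_space J) -> \bar R}) (K : eqType) (g : K -> J) :
    exists m'' : {measure set (coin_space K) -> \bar R},
      forall B, m'' B = m' (reindex g @^-1` B).
  by unshelve eexists (pushforward m' (reindex g : coin_space J -> coin_space K));
    [exact: measurable_reindex|].
have mpre (K : eqType) (g : K -> J) (A : set (coin_space K)) : measurable A ->
    measurable (reindex g @^-1` A : set (coin_space J)).
  by move=> mA; rewrite -[X in measurable X]setTI; exact: measurable_reindex.
have fin (K : eqType) (m' : {measure set (coin_space K) -> \bar R}) : fair m' ->
    m' setT = 1%E.
  by move=> fm'; rewrite -cylinder_nil fm'.
have m2fin (B : set (coin_space J2)) : measurable B -> m2 B \is a fin_num.
  move=> mB; rewrite ge0_fin_numE // (@le_lt_trans _ _ (m2 setT)) //.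
    by apply: le_measure; rewrite ?inE.
  by rewrite fin // ltry.
have step1 s (B : set (coin_space J2)) : uniq (unzip1 s) -> measurable B ->
    m (reindex g1 @^-1` cylinder s `&` reindex g2 @^-1` B) =
    (((2^-1) ^+ size s)%:E * m2 B)%E.
  move=> us mB.
  have ms := mpre _ g1 _ (measurable_cylinder s).
  have [m' m'E] := pre (mrestr m ms) _ g2.
  have r0 : 0 <= (2^-1 : R) ^+ size s by rewrite exprn_ge0 // invr_ge0.
  pose m'' := mscale (NngNum r0) m2.
  rewrite -[RHS]/(m'' B) setIC -[LHS]/(mrestr m ms (reindex g2 @^-1` B)) -m'E.
  apply: coin_measure_unique => // [|s' us'].
    rewrite m'E /mrestr (@le_lt_trans _ _ (m setT)) //.
      by apply: le_measure; rewrite ?inE //; apply: measurableI => //; exact: mpre.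
    by rewrite fin // ltry.
  rewrite -[RHS]/(((2^-1) ^+ size s)%:E * m2 (cylinder s'))%E.
  rewrite m'E -[LHS]/(m (reindex g2 @^-1` cylinder s' `&` reindex g1 @^-1` cylinder s)).
  rewrite fm2 // !reindex_cylinder.
  rewrite (_ : _ `&` _ =
      cylinder ([seq (g2 p.1, p.2) | p <- s'] ++ [seq (g1 p.1, p.2) | p <- s])).
    rewrite fm; first by rewrite size_cat !size_map -EFinM -exprD addnC.
    rewrite /unzip1 map_cat -/(unzip1 _) -/(unzip1 _) !unzip1_reindex cat_uniq.
    rewrite (map_inj_uniq ig1) (map_inj_uniq ig2) us us' /= andbT.
    apply/hasPn => _ /mapP[i _ ->]; apply/mapP => -[j _ ij].
    by move: (g12 i j); rewrite ij eqxx.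
  apply/seteqP; split => b; rewrite /cylinder /= all_cat; last by move/andP.
  by move=> [? ?]; apply/andP.
move=> A B mA mB.
have mB' := mpre _ g2 _ mB.
have [m' m'E] := pre (mrestr m mB') _ g1.
pose m'' := mscale (NngNum (fine_ge0 (measure_ge0 m2 B))) m1.
rewrite -[LHS]/(mrestr m mB' (reindex g1 @^-1` A)) -m'E.
transitivity (m'' A); last first.
  by rewrite -[LHS]/((fine (m2 B))%:E * m1 A)%E fineK ?m2fin // muleC.
apply: coin_measure_unique => // [|s us].
  rewrite m'E /mrestr (@le_lt_trans _ _ (m setT)) //.
    by apply: le_measure; rewrite ?inE //; apply: measurableI => //; exact: mpre.
  by rewrite fin // ltry.
rewrite -[RHS]/((fine (m2 B))%:E * m1 (cylinder s))%E.
rewrite m'E -[LHS]/(m (reindex g1 @^-1` cylinder s `&` reindex g2 @^-1` B)).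
rewrite step1 // fineK ?m2fin // fm1 //.
exact: muleC.
Qed.

End fair_reindexing.

Lemma probability_of_measure (R : realType) d (T : measurableType d)
    (m : {measure set T -> \bar R}) : m setT = 1%E ->
  exists P : probability T R, forall A, P A = m A.
Proof.
(* The Dirac mass only fills the fallback of the normalization, for zero or infinite mass, which
   total mass 1 excludes. *)
move=> m1; exists (mnormalize m (\d_(point : T))) => A.
transitivity (m A * ((fine (m setT))^-1)%:E)%E; last first.
  by rewrite m1 /= invr1 mule1.
rewrite -[LHS]/((if (m setT == 0%E) || (m setT == +oo%E) then
  fun U => \d_(point : T) U else fun U => m U * ((fine (m setT))^-1)%:E)%E A).
by rewrite m1 eqe oner_eq0.
Qed.

Lemma unzip1_fun (S : eqType) (U : eqType) (s : seq (S * U)) i u v :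
  uniq (unzip1 s) -> (i, u) \in s -> (i, v) \in s -> u = v.
Proof.
elim: s => // -[j w] s IH /= /andP[js us]; rewrite !inE !xpair_eqE.
have key x : (i, x) \in s -> (i == j) = false.
  by move=> xs; apply/eqP => ij; move/negP: js; apply; apply/mapP; exists (i, x).
move=> /orP[/andP[/eqP ij /eqP ->]|us'] /orP[/andP[/eqP ij' /eqP ->]|vs'] //.
- by have := key _ vs'; rewrite ij eqxx.
- by have := key _ us'; rewrite ij' eqxx.
- exact: IH.
Qed.

(** * Fair coins as the binary digits of a uniform variable *)

Section uniform_bits.
Context (R : realType).

Lemma uniform01 : exists lam : probability R R,
  forall A, measurable A -> lam A = lebesgue_measure (A `&` `[0, 1[%classic).
Proof.
pose D : set R := `[0, 1[%classic; have mD : measurable D by exact: measurable_itv.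
have D1 : lebesgue_measure D = 1%E.
  by rewrite lebesgue_measure_itv /= lte_fin ltr01 oppr0 adde0.
have [m mE] : exists m : {measure set R -> \bar R},
    forall A, m A = lebesgue_measure (A `&` D).
  by unshelve eexists (pushforward (mrestr (@lebesgue_measure R) mD)
    (idfun : measurableTypeR R -> R)); [move=> _ B mB; rewrite setTI|].
have [|P PE] := @probability_of_measure _ _ _ m; first by rewrite mE setTI.
by exists P => A mA; rewrite PE mE.
Qed.

Section from_uniform.
Variable lam : probability R R.
Hypothesis lamE : forall A, measurable A ->
  lam A = lebesgue_measure (A `&` `[0, 1[%classic).

Lemma measurable_bits (J : countType) : measurable_fun setT
  ((fun t (j : J) => digit 2 t (pickle j)) : R -> coin_space J).
Proof. by apply: measurable_coord_fun => j _; exact: measurable_digit. Qed.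

Lemma uniform_cylinder (c : nat -> bool) n :
  lam [set t | forall i, (i < n)%N -> digit 2 t i = c i] = ((2^-1) ^+ n)%:E.
Proof.
rewrite lamE; last first.
  rewrite (_ : [set t | _] = \bigcap_(i in `I_n) (digit 2 ^~ i @^-1` [set c i])) //.
  case: n => [|n]; first by rewrite (_ : `I_0 = set0) ?bigcap_set0 // II0.
  apply: bigcap_measurable; first by exists 0%N.
  move=> i _; rewrite -[X in measurable X]setTI; exact: measurable_digit.
pose a : R := partial_expansion 2 c n.
rewrite (_ : _ `&` _ = `[a, a + (2 ^+ n)^-1[%classic).
  rewrite lebesgue_measure_itv /= lte_fin ltrDl invr_gt0 exprn_gt0 //.
  by rewrite -EFinB addrC addKr exprVn.
have a0 : 0 <= a by exact: partial_expansion_ge0.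
have a1 : a + (2 ^+ n)^-1 <= 1 by exact: partial_expansion_le.
apply/seteqP; split => t /=; rewrite !in_itv /=.
  by move=> [tc t01]; apply/binary_cylinder.
move=> t_in; have t01 : 0 <= t < 1 by lra.
by split => //; apply/(binary_cylinder c n t01).
Qed.

(** Induction on the number of free positions below [n]. With none left, the list prescribes a full
    prefix; otherwise the event is split by the bit at a free position, and the two halves have
    equal measure. *)
Lemma uniform_pairs n (s : seq (nat * bool)) : uniq (unzip1 s) ->
  all (fun i => (i < n)%N) (unzip1 s) ->
  lam [set t | cylinder s (digit 2 t)] = ((2^-1) ^+ size s)%:E.
Proof.
have mdig s' : measurable [set t : R | cylinder s' (digit 2 t)].
  rewrite -[X in measurable X]setTI.
  have mD : measurable_fun setT (digit 2 : R -> coin_space nat).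
    by apply: measurable_coord_fun => j _; exact: measurable_digit.
  exact: (mD measurableT _ (measurable_cylinder s')).
have [k] := ubnP (n - size s); elim: k s => // k IH s.
rewrite ltnS => nsk us sn.
have sub : {subset unzip1 s <= iota 0 n}.
  by move=> i /(allP sn); rewrite mem_iota.
have sz : (size s <= n)%N.
  by rewrite -(size_map fst) -(size_iota 0 n); exact: uniq_leq_size.
have [szn|szn] := eqVneq (size s) n.
  have [_ mem] : (size (unzip1 s) = size (iota 0 n)) * (unzip1 s =i iota 0 n).
    by apply: uniq_min_size => //; rewrite size_map size_iota szn.
  rewrite szn -(uniform_cylinder (fun i => (i, true) \in s)); congr (lam _).
  have lookup i b : (i, b) \in s -> ((i, true) \in s) = b.
    case: b => // ifs; apply/negbTE/negP => its.
    by have := unzip1_fun us its ifs.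
  apply/seteqP; split => t /=.
    move=> /allP st i; rewrite -[(i < n)%N]/(0 <= i < 0 + n)%N -mem_iota -mem.
    move=> /mapP[[j b] jbs ->]; rewrite (lookup _ _ jbs).
    by have /eqP := st _ jbs.
  move=> tc; apply/allP => -[i b] ibs /=; rewrite tc ?(lookup _ _ ibs) //.
  by move/allP : sn; apply; apply/mapP; exists (i, b).
have [i [iN is']] : exists i, (i < n)%N /\ i \notin unzip1 s.
  apply: contrapT => H; move/eqP : szn; apply; apply/eqP; rewrite eqn_leq sz /=.
  rewrite -(size_map fst) -[leqLHS](size_iota 0 n); apply: uniq_leq_size.
    exact: iota_uniq.
  move=> i; rewrite mem_iota /= add0n => iN; apply: contrapT => /negP is'.
  by apply: H; exists i.
have step b : lam [set t | cylinder ((i, b) :: s) (digit 2 t)] =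
    ((2^-1) ^+ (size s).+1)%:E.
  apply: IH => /=.
  - have nz : (0 < n - size s)%N by rewrite subn_gt0 ltn_neqAle szn sz.
    by rewrite subnS -ltnS prednK.
  - exact/andP.
  - exact/andP.
rewrite (_ : [set t | _] = [set t | cylinder ((i, true) :: s) (digit 2 t)] `|`
    [set t | cylinder ((i, false) :: s) (digit 2 t)]).
  rewrite measureU //.
    apply: etrans (congr2 adde (step true) (step false)) _.
    rewrite -[LHS]/(((2^-1 : R) ^+ (size s).+1 + 2^-1 ^+ (size s).+1)%:E).
    by rewrite exprS; congr EFin; lra.
  apply/seteqP; split => // t; rewrite /cylinder /=.
  by move=> [/andP[/eqP -> _] /andP[]].
apply/seteqP; split => t; rewrite /cylinder /=.
  by move=> st; case: (digit 2 t i) => /=; [left|right].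
by move=> [] /andP[].
Qed.

Lemma fair_bits (J : countType) s : uniq (unzip1 s) ->
  lam [set t | cylinder s (fun j : J => digit 2 t (pickle j))] =
    ((2^-1) ^+ size s)%:E.
Proof.
move=> us.
(* Any strict bound on the encoded positions would do; the maximum of their successors is one. *)
have := @uniform_pairs (foldr maxn 0%N (map S (unzip1 [seq (pickle p.1, p.2) | p <- s])))
  [seq (pickle p.1, p.2) | p <- s].
rewrite size_map => <-.
- by congr (lam _); apply/seteqP; split => t; rewrite /cylinder /= all_map.
- by rewrite unzip1_reindex map_inj_uniq //; exact: (pcan_inj pickleK).
- apply/allP => i; elim: (unzip1 _) => // j r IH /=.
  rewrite inE leq_max => /orP[/eqP -> |/IH ->]; rewrite ?leqnn ?orbT //.
Qed.

(** No infinite product of measures is formed: the coins are the digits of one uniform variable,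
    with positions assigned by [pickle]. *)
Lemma fair_exists (J : countType) : exists m : {measure set (coin_space J) -> \bar R},
  fair m /\ forall A, m A = lam [set t | A (fun j : J => digit 2 t (pickle j))].
Proof.
have [m mE] : exists m : {measure set (coin_space J) -> \bar R},
    forall A, m A = lam [set t | A (fun j : J => digit 2 t (pickle j))].
  by unshelve eexists (pushforward lam
    ((fun t (j : J) => digit 2 t (pickle j)) : R -> coin_space J));
    [exact: measurable_bits|].
exists m; split => // s us; rewrite mE; exact: fair_bits.
Qed.

End from_uniform.

End uniform_bits.

Section fair_uniform.
Context (R : realType).

(** By uniqueness of the fair measure the coins may be taken to be the digits of a uniform variable,
    and on [[0, 1)] expanding these digits returns the variable. *)
Lemma fair_uniform (lam : probability R R) (m : {measure set (coin_space nat) -> \bar R}) :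
  (forall A, measurable A -> lam A = lebesgue_measure (A `&` `[0, 1[%classic)) ->
  fair m -> forall Z : set R, measurable Z -> m [set b | Z (expansion 2 b)] = lam Z.
Proof.
move=> lamE fm Z mZ.
have [m' [fm' m'E]] := fair_exists lamE nat.
have mZ' : measurable ([set b | Z (expansion 2 b)] : set (coin_space nat)).
  rewrite -[X in measurable X]setTI.
  exact: (measurable_expansion (lexx 2) measurableT mZ).
rewrite (fair_unique fm fm' mZ') m'E.
have mK : measurable [set t : R | Z (expansion 2 (digit (2 : R) t))].
  have md : measurable_fun setT (digit 2 : R -> coin_space nat).
    by apply: measurable_coord_fun => j _; exact: measurable_digit.
  by rewrite -[X in measurable X]setTI; exact: (md measurableT _ mZ').
rewrite !lamE //; congr lebesgue_measure.
by apply/seteqP; split => t /= [+ t01]; rewrite binary_expansionK //;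
  move: t01; rewrite in_itv.
Qed.

End fair_uniform.

(** * Coding a standard Borel space by bits *)

Section polish_retract.
Context (R : realType) (d : measure_display) (T : measurableType d).

(** A point is coded by the small balls around dense points that contain it. Decoding takes at each
    scale the first listed ball and follows the centres to their limit, which recovers a coded
    point; code words whose centres are not Cauchy go to [point]. *)
Lemma standard_borel_retract : standard_borel R T ->
  exists (iota : T -> coin_space nat) (rho : coin_space nat -> T),
    [/\ measurable_fun setT iota, measurable_fun setT rho & cancel iota rho].
Proof.
move=> [P [f [haus [D cD denD] [finv fK finvK] mE]]].
have [num num_inj] := countable_injP _ cD.
pose p0 : P := f point.
pose pt n : P := xget p0 [set x | D x /\ num x = n].
have ptE x : D x -> pt (num x) = x.
  move=> Dx; rewrite /pt; case: xgetP => [y -> [Dy yx]|/(_ x)]; last by case.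
  by apply: num_inj; rewrite ?inE.
(* The interior is taken because a ball of a pseudometric structure need not be open; openness makes
   each bit of the code measurable. *)
pose U n k : set P := (ball (pt n) (k.+1%:R^-1 : R))°.
have e0 k : 0 < k.+1%:R^-1 :> R by [].
have U_cover x k : exists n, U n k x.
  pose e : R := k.+1%:R^-1 / 2.
  have e_gt0 : 0 < e by rewrite divr_gt0.
  have [y [By Dy]] : (ball x e)° `&` D !=set0.
    apply: denD; last exact: open_interior.
    by exists x; exact: nbhsx_ballx.
  exists (num y); rewrite /U ptE //.
  apply: (@filterS _ _ _ (ball x e)); last exact: nbhsx_ballx.
  move=> z xz; rewrite [k.+1%:R^-1]splitr.
  apply: ball_triangle xz; apply: ball_sym; exact: interior_subset By.
pose iota x : nat -> bool := fun i =>
  if unpickle i is Some (n, k) then `[< U n k (f x) >] else false.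
pose least (b : nat -> bool) (k n : nat) : Prop := b (pickle (n, k)) /\
  forall m, (m < n)%N -> ~~ b (pickle (m, k)).
(* The default 0 concerns code words listing no ball at scale [k]; the code of a point always lists
   one, by [U_cover]. *)
pose idx (b : nat -> bool) (k : nat) : nat := xget 0%N (least b k).
pose z (b : nat -> bool) (k : nat) : P := pt (idx b k).
have mcoord i c : measurable ([set b | b i = c] : set (coin_space nat)).
  rewrite -[X in measurable X]setTI.
  exact: (@measurable_coord_proj _ _ bool [set: nat] i I measurableT [set c]).
have mleast k n : measurable ([set b | least b k n] : set (coin_space nat)).
  rewrite (_ : [set b | _] = [set b | b (pickle (n, k)) = true] `&`
    \bigcap_(m in `I_n) [set b | b (pickle (m, k)) = false]).
    apply: measurableI => //; case: n => [|n]; first by rewrite II0 bigcap_set0.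
    by apply: bigcap_measurable => //; exists 0%N.
  apply/seteqP; split => b /= [bn bm]; split => // m mn.
    exact/negbTE/bm.
  by rewrite (bm m mn).
have least_uniq b k n n' : least b k n -> least b k n' -> n = n'.
  move=> [bn nbn] [bn' nbn']; case: (ltngtP n n') => // lt.
    by move: (nbn' _ lt); rewrite bn.
  by move: (nbn _ lt); rewrite bn'.
have midx k n : measurable ([set b | idx b k = n] : set (coin_space nat)).
  rewrite (_ : [set b | _] = [set b | least b k n] `|`
    (if n == 0%N then \bigcap_m ~` [set b | least b k m] else set0)).
    apply: measurableU => //; case: ifP => // _.
    by apply: bigcapT_measurable => m; exact: measurableC.
  apply/seteqP; split => b /=.
    rewrite /idx; case: xgetP => [m -> lm <-|nl <-]; first by left.
    by right; rewrite eqxx => m _; exact: nl.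
  rewrite /idx; case: xgetP => [m -> lm|nl].
    move=> [|]; first exact: least_uniq.
    by case: ifP => // _ nl; case: (nl _ Logic.I lm).
  by move=> [ln|]; [case: (nl n)|case: eqP].
(* [V] is arbitrary: [z b k] takes countably many values, each on a measurable set of codes. The
   sets [Vj] below rely on this generality. *)
have mz k (V : set P) : measurable ([set b | V (z b k)] : set (coin_space nat)).
  rewrite (_ : [set b | _] = \bigcup_(n in [set n | V (pt n)]) [set b | idx b k = n]).
    exact: bigcup_measurable.
  by apply/seteqP; split => b /=; [move=> Vb; exists (idx b k)|move=> [n /= Vn bn]; rewrite /z bn].
pose G : set (coin_space nat) := [set b | forall j, exists K, forall k,
  (K <= k)%N -> ball (z b K) (j.+1%:R^-1 : R) (z b k)].
have mG : measurable G.
  rewrite (_ : G = \bigcap_j \bigcup_K \bigcap_(k in [set k | (K <= k)%N])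
      \bigcup_n ([set b | idx b K = n] `&` [set b | ball (pt n) (j.+1%:R^-1 : R) (z b k)])).
    apply: bigcapT_measurable => j; apply: bigcupT_measurable => K.
    apply: bigcap_measurable; first by exists K => /=.
    move=> k _; apply: bigcupT_measurable => n; apply: measurableI => //.
  apply/seteqP; split => b /= Gb j.
    move=> _; have [K HK] := Gb j; exists K => // k /= Kk.
    by exists (idx b K) => //; split => //; exact: HK.
  have [K _ HK] := Gb j Logic.I; exists K => k Kk.
  by have [n _ [/= <- ]] := HK k Kk.
have Gcvg b : G b -> cvg (z b @ \oo).
  move=> Gb; apply: cauchy_cvg; apply: cauchy_exP => e e_gt0.
  have [j _ je] : exists2 j, True & (j.+1%:R^-1 : R) < e.
    exists (Num.truncn e^-1) => //.
    by rewrite invf_plt ?posrE // truncnS_gt.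
  have [K HK] := Gb j; exists (z b K); exists K => // k /= Kk.
  apply: le_ball (HK k Kk); exact: ltW.
pose rho b : T := if pselect (G b) then finv (lim (z b @ \oo)) else point.
exists iota, rho; split.
- apply: measurable_coord_fun => i _ _ B mB; rewrite setTI.
  rewrite /iota; case: (unpickle i) => [[n k]|]; last first.
    by rewrite preimage_cst; case: ifP.
  have mU : measurable [set x | U n k (f x)].
    apply/mE; apply: sub_sigma_algebra.
    rewrite (_ : f @` _ = U n k); first exact: open_interior.
    apply/seteqP; split => [_ [x Ux <-]//|y Uy].
    by exists (finv y); rewrite /= finvK.
  have mb : measurable_fun setT (fun x => `[< U n k (f x) >]).
    apply: (measurable_fun_bool true).
    by rewrite setTI (_ : _ @^-1` _ = [set x | U n k (f x)]) //;
      apply/seteqP; split => x /= /asboolP.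
  by rewrite -[X in measurable X]setTI; exact: mb.
- have small (e : R) : 0 < e -> exists j : nat, j.+1%:R^-1 < e :> R.
    move=> e_gt0; exists (Num.truncn e^-1).
    by rewrite invf_plt ?posrE // truncnS_gt.
  have mopen V : <<s @open P >> V -> measurable (G `&` [set b | V (lim (z b @ \oo))]).
    pose DD := [set V : set P | measurable (G `&` [set b | V (lim (z b @ \oo))])].
    move: V; suff : <<s @open P >> `<=` DD by exact.
    apply: smallest_sub; first split => /=.
    - by rewrite /DD /= (_ : [set b | _] = set0) ?setI0.
    - move=> W DW; rewrite /DD /= (_ : _ `&` _ =
        G `\` (G `&` [set b | W (lim (z b @ \oo))])); first exact: measurableD.
      by apply/seteqP; split => b /= [Gb]; [move=> [_ nW]; split => // -[]|
        move=> nW; split => //; split => // Wb; apply: nW].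
    - move=> W DW; rewrite /DD /= (_ : _ `&` _ =
        \bigcup_n (G `&` [set b | W n (lim (z b @ \oo))])).
        exact: bigcupT_measurable.
      by apply/seteqP; split => b /= [];
        [move=> Gb [n _ Wn]; exists n|move=> n _ [Gb Wn]; split => //; exists n].
    (* The limit lies in the open set [V] exactly when, for some [j], the centres eventually lie in
       [Vj j], that is, inside [V] with a fixed margin. *)
    move=> V oV; pose Vj j : set P := [set q | ball q (j.+1%:R^-1 : R) `<=` V].
    rewrite /DD /= (_ : _ `&` _ = G `&` \bigcup_j \bigcup_K
        \bigcap_(k in [set k | (K <= k)%N]) [set b | Vj j (z b k)]).
      apply: measurableI => //; apply: bigcupT_measurable => j.
      apply: bigcupT_measurable => K; apply: bigcap_measurable; first by exists K => /=.
      by move=> k _; exact: mz.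
    apply/seteqP; split => b /= [Gb].
      move=> Vl; split => //.
      have [e /= e_gt0 eV] : exists2 e : R, 0 < e & ball (lim (z b @ \oo)) e `<=` V.
        have /nbhs_ballP[e /= e_gt0 eV] : nbhs (lim (z b @ \oo)) V.
          exact: open_nbhs_nbhs.
        by exists e.
      have [|j je] := small (e / 2); first by rewrite divr_gt0.
      have [K _ HK] : \forall k \near \oo, ball (lim (z b @ \oo)) (j.+1%:R^-1 : R) (z b k).
        by apply: (Gcvg _ Gb); exact: nbhsx_ballx.
      exists j => //; exists K => // k /= Kk q kq; apply: eV.
      apply: (@le_ball _ _ _ (j.+1%:R^-1 + j.+1%:R^-1)).
        by rewrite (splitr e) lerD // ltW.
      by apply: ball_triangle kq; exact: HK.
    move=> [j _ [K _ HK]]; split => //.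
    have [K' _ HK'] : \forall k \near \oo, ball (lim (z b @ \oo)) (j.+1%:R^-1 : R) (z b k).
      by apply: (Gcvg _ Gb); exact: nbhsx_ballx.
    apply: (HK (maxn K K') (leq_maxl _ _)); apply: ball_sym.
    exact: (HK' _ (leq_maxr _ _)).
  move=> _ B mB; rewrite setTI.
  rewrite (_ : _ @^-1` B = (G `&` [set b | (f @` B) (lim (z b @ \oo))]) `|`
      (~` G `&` [set b | B point])).
    apply: measurableU; first by apply: mopen; apply/mE.
    apply: measurableI; first exact: measurableC.
    have [Bp|nBp] := pselect (B point).
      by rewrite (_ : [set b | _] = setT) //; apply/seteqP; split.
    by rewrite (_ : [set b | _] = set0) //; apply/seteqP; split.
  apply/seteqP; split => b /=; rewrite /rho; case: pselect => Gb.
  - by move=> Bl; left; split => //; exists (finv (lim (z b @ \oo))); rewrite // finvK.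
  - by move=> Bp; right.
  - by move=> [[_ [x Bx <-]]|[]//]; rewrite fK.
  - by move=> [[]//|[]].
move=> x; pose b := iota x.
have bU k : ball (z b k) (k.+1%:R^-1 : R) (f x).
  have : least b k (idx b k).
    rewrite /idx; case: xgetP => [m _ //|nl].
    have : exists n : nat, b (pickle (n, k)).
      have [n Un] := U_cover (f x) k; exists n.
      by rewrite /b /iota pickleK; exact/asboolP.
    move=> /ex_minnP[n bn minn]; case: (nl n); split => // m mn.
    by apply/negP => /minn; rewrite leqNgt mn.
  move=> [+ _]; rewrite /b /iota pickleK => /asboolP.
  exact: interior_subset.
have zx : z b @ \oo --> f x.
  apply/cvg_ballP => e e_gt0; exists (Num.truncn e^-1) => // k /= ke.
  apply: ball_sym; apply: le_ball (bU k); apply: ltW.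
  rewrite invf_plt ?posrE // (lt_le_trans (truncnS_gt _)) // ler_nat ltnS //.
have Gb : G b.
  move=> j; exists (j.+1 * 2)%N => k jk; rewrite [j.+1%:R^-1]splitr.
  apply: (@ball_triangle _ _ (f x)).
    apply: le_ball (bU _); rewrite -invfM -natrM lef_pV2 ?posrE ?ltr0n //.
    by rewrite ler_nat.
  apply: ball_sym; apply: le_ball (bU k); rewrite -invfM -natrM lef_pV2 ?posrE ?ltr0n //.
  by rewrite ler_nat (leq_trans jk).
rewrite /rho; case: pselect => [Gx|//].
by rewrite /= (cvg_lim haus zx) fK.
Qed.

End polish_retract.

(** * Randomization: the next state decoded from a uniform variable *)

Section prefixes.

(** The newest bit stands at the head, so that extending a prefix is a [cons] and recursion on the
    list runs from the latest bit backwards. *)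
Fixpoint prefix_rev (b : nat -> bool) (n : nat) : seq bool :=
  if n is m.+1 then b m :: prefix_rev b m else [::].

Lemma size_prefix_rev b n : size (prefix_rev b n) = n.
Proof. by elim: n => //= n ->. Qed.

Lemma drop_prefix_rev b n k : drop k (prefix_rev b (k + n)) = prefix_rev b n.
Proof. by elim: k => [|k IH]; rewrite ?drop0. Qed.

Definition prefix_set (y : seq bool) : set (nat -> bool) :=
  [set b | prefix_rev b (size y) = y].

Definition prefix_sets : set (set (nat -> bool)) :=
  [set A | A = set0 \/ exists y, A = prefix_set y].

Lemma prefix_sets_setI : setI_closed prefix_sets.
Proof.
have key y y' : (size y <= size y')%N ->
    prefix_sets (prefix_set y `&` prefix_set y').
  move=> yy'; have drop_y' b : prefix_set y' b ->
      prefix_rev b (size y) = drop (size y' - size y) y'.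
    move=> by'; have := drop_prefix_rev b (size y) (size y' - size y).
    by rewrite subnK // [prefix_rev b (size y')]by'.
  have [E|ne] := eqVneq (drop (size y' - size y) y') y.
    right; exists y'; apply/seteqP; split => b; first by case.
    by move=> by'; split => //; rewrite /prefix_set /= drop_y'.
  left; apply/seteqP; split => // b [/= yb /drop_y']; rewrite yb => E.
  by move: ne; rewrite -E eqxx.
move=> _ _ [->|[y ->]] [->|[y' ->]]; rewrite ?set0I ?setI0; do ?by left.
by have [/key//|/ltnW/key] := leqP (size y) (size y'); rewrite setIC.
Qed.

Lemma measurable_prefix_set y :
  measurable (prefix_set y : set (coin_space nat)).
Proof.
elim: y => [|c y IH].
  by rewrite (_ : prefix_set _ = setT) //; apply/seteqP; split.
rewrite (_ : prefix_set _ = prefix_set y `&`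
    ((fun b : coin_space nat => b (size y)) @^-1` [set c])).
  apply: measurableI => //; rewrite -[X in measurable X]setTI.
  exact: (@measurable_coord_proj _ _ bool [set: nat] (size y)).
apply/seteqP; split => b; first by move=> [bc by_].
by move=> [by_ bc]; rewrite /prefix_set /= [b _]bc [prefix_rev _ _]by_.
Qed.

Lemma sigma_prefix_sets : @measurable _ (coin_space nat) = <<s prefix_sets >>.
Proof.
apply/seteqP; split; apply: smallest_sub; do ?exact: smallest_sigma_algebra.
  move=> _ [n _ [B _ <-]]; rewrite setTI.
  pose FT : measurableType _ := g_sigma_algebraType prefix_sets.
  rewrite (_ : _ @^-1` B = \bigcup_(y : seq bool)
      if (size y == n.+1) && `[< B (head false y) >] then prefix_set y else set0).
    apply: (@countable_bigcupT_measurable _ FT) => // y.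
    case: ifP => // _; apply: sub_sigma_algebra; right; by exists y.
  apply/seteqP; split => b /=.
    move=> Bb; exists (prefix_rev b n.+1) => //.
    by rewrite size_prefix_rev eqxx /= asboolT //= /prefix_set /= size_prefix_rev.
  move=> [y _]; case: ifP => // /andP[/eqP sy /asboolP Bh].
  by rewrite /prefix_set /= sy => by'; move: Bh; rewrite -by'.
by move=> _ [->|[y ->]]; [exact: measurable0|exact: measurable_prefix_set].
Qed.

End prefixes.

Section randomization.
Context (R : realType) (d0 d : measure_display).
Context (T : measurableType d0) (Omega : measurableType d).
Variables (mu : probability Omega R) (X : {mfun Omega >-> T}).
Variable Y : {mfun Omega >-> coin_space nat}.
Variable lam : probability R R.
Hypothesis lamE : forall A, measurable A ->
  lam A = lebesgue_measure (A `&` `[0, 1[%classic).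

Variable p : seq bool -> T -> R.
Hypothesis mp : forall y, measurable_fun setT (p y).
Hypothesis p0 : forall y x, 0 <= p y x.

(* Arithmetic decoding: given [x], the prefix [y] (read backwards) is output
   exactly when the uniform variable [t] lies in an interval of length [p y x]
   starting at [low y x]. *)
Fixpoint low (y : seq bool) (x : T) : R :=
  if y is c :: y' then low y' x + (if c then p (false :: y') x else 0) else 0.

Fixpoint decode_rev (x : T) (t : R) (n : nat) : seq bool :=
  if n is m.+1 then
    let y := decode_rev x t m in (low y x + p (false :: y) x <= t) :: y
  else [::].

Definition decode (x : T) (t : R) (n : nat) : bool :=
  head false (decode_rev x t n.+1).

Lemma prefix_decode x t n : prefix_rev (decode x t) n = decode_rev x t n.
Proof. by elim: n => //= n ->. Qed.

Lemma measurable_low y : measurable_fun setT (low y).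
Proof.
elim: y => [|c y IH] /=; first exact: measurable_cst.
by apply: measurable_funD => //; case: c.
Qed.

Lemma measurable_decode_rev y : measurable
  [set z : T * R | decode_rev z.1 z.2 (size y) = y].
Proof.
elim: y => [|c y IH].
  by rewrite (_ : [set z | _] = setT) //; apply/seteqP; split.
rewrite (_ : [set z | _] = [set z | decode_rev z.1 z.2 (size y) = y] `&`
    ((fun z : T * R => low y z.1 + p (false :: y) z.1 <= z.2) @^-1` [set c])).
  apply: measurableI => //; rewrite -[X in measurable X]setTI.
  have mf : measurable_fun setT (fun z : T * R => low y z.1 + p (false :: y) z.1 <= z.2).
    apply: measurable_fun_ler; last exact: measurable_snd.
    apply: measurable_funD; apply: measurableT_comp => //.
    exact: measurable_low.
  exact: mf.
apply/seteqP; split => z /=; first by move=> [+ zy]; rewrite zy.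
by move=> [zy zc]; rewrite zy zc.
Qed.

Lemma measurable_decode :
  measurable_fun setT ((fun z => decode z.1 z.2) : T * R -> coin_space nat).
Proof.
apply: measurable_coord_fun => n _ _ B mB; rewrite setTI.
rewrite (_ : _ @^-1` B = \bigcup_(y : seq bool)
    if (size y == n.+1) && `[< B (head false y) >]
    then [set z : T * R | decode_rev z.1 z.2 (size y) = y] else set0).
  apply: countable_bigcupT_measurable => // y.
  by case: ifP => // _; exact: measurable_decode_rev.
apply/seteqP; split => z /=.
  move=> Bz; exists (decode_rev z.1 z.2 n.+1) => //.
  have sz : size (decode_rev z.1 z.2 n.+1) = n.+1.
    by rewrite -prefix_decode size_prefix_rev.
  by rewrite sz eqxx asboolT.
move=> [y _]; case: ifP => // /andP[/eqP sy /asboolP Bh] /=.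
by rewrite sy => yE; move: Bh; rewrite -yE.
Qed.

(** Additivity of [p] cuts the interval of [y] into that of [false :: y] on the left and that of
    [true :: y] on the right; the decoder compares [t] with the cut point. *)
Lemma decode_interval x t y : p [::] x = 1 ->
  (forall y, p y x = p (false :: y) x + p (true :: y) x) -> 0 <= t < 1 ->
  decode_rev x t (size y) = y <-> low y x <= t < low y x + p y x.
Proof.
move=> px0 px t01; elim: y => [|c y IH] /=; first by rewrite px0 add0r.
have py := px y; have pf := p0 (false :: y) x; have pt := p0 (true :: y) x.
split.
  move=> [+ ty]; rewrite ty; move/IH : ty => /andP[h1 h2].
  case: c; first by move=> tc; apply/andP; split; lra.
  by move=> /negbT; rewrite -ltNge => tc; apply/andP; split; lra.
move=> /andP[h1 h2]; have ty : decode_rev x t (size y) = y.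
  by apply/IH/andP; case: c h1 h2 => h1 h2; split; lra.
rewrite ty; congr cons; case: c h1 h2 => h1 h2; first lra.
by apply/negbTE; rewrite -ltNge; lra.
Qed.

Lemma low_bounds x y : p [::] x = 1 ->
  (forall y, p y x = p (false :: y) x + p (true :: y) x) ->
  0 <= low y x /\ low y x + p y x <= 1.
Proof.
move=> px0 px; elim: y => [|c y [l0 l1]] /=; first by rewrite px0 add0r lexx.
have := px y; have := p0 (false :: y) x; have := p0 (true :: y) x.
by case: c; split; lra.
Qed.

Lemma decode_measure x y : p [::] x = 1 ->
  (forall y, p y x = p (false :: y) x + p (true :: y) x) ->
  lam [set t | decode_rev x t (size y) = y] = (p y x)%:E.
Proof.
move=> px0 px; rewrite lamE; last first.
  rewrite (_ : [set t | _] =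
    xsection [set z : T * R | decode_rev z.1 z.2 (size y) = y] x).
    exact: measurable_xsection (measurable_decode_rev y).
  by apply/seteqP; split => t; rewrite /xsection /= inE.
have [l0 l1] := low_bounds y px0 px.
rewrite (_ : _ `&` _ = `[low y x, low y x + p y x[%classic).
  rewrite lebesgue_measure_itv /= lte_fin ltrDl; case: ltP => [_|py].
    by rewrite -EFinB addrC addKr.
  by congr EFin; apply/eqP; rewrite eq_le p0.
apply/seteqP; split => t /=; rewrite !in_itv /=.
  by move=> [ty t01]; apply/decode_interval.
move=> t_in; have t01 : 0 <= t < 1 by lra.
by split => //; apply/decode_interval.
Qed.

End randomization.

Section randomization_exists.
Context (R : realType) (d0 d : measure_display).
Context (T : measurableType d0) (Omega : measurableType d).
Variables (mu : probability Omega R) (X : {mfun Omega >-> T}).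
Variable lam : probability R R.
Hypothesis lamE : forall A, measurable A ->
  lam A = lebesgue_measure (A `&` `[0, 1[%classic).

Let pi : probability T R := distribution mu (X : {RV mu >-> T}).

Let mX C : measurable C -> measurable (X @^-1` C).
Proof. by move=> mC; rewrite -[_ @^-1` _]setTI; exact: measurable_funPT. Qed.

Lemma conditional_probability (E : set Omega) : measurable E ->
  exists p : T -> R, [/\ measurable_fun setT p, (forall x, 0 <= p x),
    (forall x, p x <= 1) & forall C, measurable C ->
      mu (X @^-1` C `&` E) = (\int[pi]_(x in C) (p x)%:E)%E].
Proof.
move=> mE; have [|||p [mp p0 p1 pE]] := @conditioning _ _ _ _ _ mu X (\1_E) 1.
- exact: measurable_indic.
- by move=> w; rewrite indicE ler0n.
- by move=> w; rewrite indicE lern1 leq_b1.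
exists p; split => // C mC.
have := conditioning_set pE mC.
rewrite integral_indic; [|exact: mX|by []]; rewrite setIC => ->.
rewrite [RHS]ge0_integral_pushforward //.
  by apply: measurable_funTS; exact/measurable_EFinP.
by move=> x _; rewrite lee_fin.
Qed.

(** [p y] is the conditional probability, given [X], that [Y] starts with the prefix [y]. Where
    these numbers are consistent, decoding gives each prefix its conditional probability;
    integrating over the state and uniqueness of measures do the rest. *)
Lemma decode_law (Y : {mfun Omega >-> coin_space nat}) :
  exists dec : T * R -> nat -> bool,
    measurable_fun setT (dec : T * R -> coin_space nat) /\
    forall C (D : set (coin_space nat)), measurable C -> measurable D ->
      (pi \x lam)%E [set z | C z.1 /\ D (dec z)] =
      mu [set w | C (X w) /\ D (Y w)].
Proof.
have mY D : measurable D -> measurable (Y @^-1` D).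
  by move=> mD; rewrite -[_ @^-1` _]setTI; exact: measurable_funPT.
pose E y := Y @^-1` prefix_set y.
have mE y : measurable (E y) by apply: mY; exact: measurable_prefix_set.
have /choice[p pP] := fun y => conditional_probability (mE y).
have mp y : measurable_fun setT (p y) by have [] := pP y.
have p0 y x : 0 <= p y x by have [_ /(_ x)] := pP y.
have p1 y x : p y x <= 1 by have [_ _ /(_ x)] := pP y.
have pE y C : measurable C -> mu (X @^-1` C `&` E y) = (\int[pi]_(x in C) (p y x)%:E)%E.
  by have [_ _ _] := pP y; exact.
have mEp y : measurable_fun setT (fun x => (p y x)%:E) by exact/measurable_EFinP.
have Ip y : pi.-integrable setT (fun x => (p y x)%:E).
  by apply: (@bounded_integrable _ _ _ pi (p y) 1) => // x; rewrite ger0_norm.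
have good0 : {ae pi, forall x, p [::] x = 1}.
  have : ae_eq pi setT (fun x => (p [::] x)%:E) (cst 1%E).
    apply: integral_ae_eq => // C _ mC.
    rewrite -pE // integral_cst // mul1e; congr (mu _).
    by apply/seteqP; split => w // [].
  by apply: filterS => x /(_ I) [].
have goodS : {ae pi, forall x, forall y, p y x = p (false :: y) x + p (true :: y) x}.
  have gS y : {ae pi, forall x, p y x = p (false :: y) x + p (true :: y) x}.
    have : ae_eq pi setT (fun x => (p y x)%:E)
        (fun x => (p (false :: y) x)%:E + (p (true :: y) x)%:E)%E.
      apply: integral_ae_eq => //; first exact: emeasurable_funD.
      move=> C _ mC; rewrite ge0_integralD //.
      - rewrite -!pE // -measureU.
        + congr (mu _); apply/seteqP; split => w /=.
            move=> [Cw Ew]; case c : (Y w (size y)); [right|left]; split => //;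
            by rewrite /E /prefix_set /= c [prefix_rev _ _]Ew.
          by move=> [[Cw []]|[Cw []]].
        + by apply: measurableI => //; exact: mX.
        + by apply: measurableI => //; exact: mX.
        + by apply/seteqP; split => // w [[_ [+ _]] [_ [+ _]]] => ->.
      - by move=> x _; rewrite lee_fin.
      - exact: measurable_funTS.
      - by move=> x _; rewrite lee_fin.
      - exact: measurable_funTS.
    by apply: filterS => x /(_ I) [].
  (* Each additivity relation has its own null set; enumerating the countably many prefixes merges
     them into one. *)
  have : {ae pi, forall x, forall n : nat,
      (fun y => p y x = p (false :: y) x + p (true :: y) x) (odflt [::] (unpickle n))}.
    by apply/ae_foralln => n; exact: gS.
  by apply: filterS => x H y; have := H (pickle y); rewrite pickleK.
pose dec z : nat -> bool := decode p z.1 z.2.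
have mdec : measurable_fun setT (dec : T * R -> coin_space nat).
  exact: measurable_decode.
exists dec; split => // C D mC mD.
have prefE y : (pi \x lam)%E [set z | C z.1 /\ prefix_set y (dec z)] =
    mu (X @^-1` C `&` E y).
  have EE : [set z | C z.1 /\ prefix_set y (dec z)] =
      [set z | C z.1 /\ decode_rev p z.1 z.2 (size y) = y].
    by apply/seteqP; split => z /=; rewrite /prefix_set /= prefix_decode.
  rewrite EE pE // [RHS]integral_mkcond /product_measure1.
  have mS : measurable [set z : T * R | C z.1 /\ decode_rev p z.1 z.2 (size y) = y].
    apply: (@measurableI _ _ [set z : T * R | C z.1]).
      by rewrite -[X in measurable X]setTI; exact: measurable_fst.
    exact: measurable_decode_rev.
  apply: ae_eq_integral => //.
  - exact: measurable_fun_xsection.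
  - by apply/measurable_restrict => //; rewrite setIidr //; exact: measurable_funTS.
  apply: filterS2 good0 goodS => x px0 px _ /=.
  rewrite patchE; case: ifPn => [/set_mem Cx|/negP nCx].
    rewrite -(decode_measure lamE mp p0 y px0 px); congr (lam _).
    by apply/seteqP; split => t; rewrite /xsection /= inE /=; [case|].
  rewrite -[RHS](measure0 lam); congr (lam _).
  apply/seteqP; split => // t; rewrite /xsection /= inE /= => -[Cx _].
  by apply: nCx; exact: mem_set.
have mC1 : measurable [set z : T * R | C z.1].
  by rewrite -[X in measurable X]setTI; exact: measurable_fst.
have [m1 m1E] : exists m1 : {measure set (coin_space nat) -> \bar R},
    forall D, m1 D = (pi \x lam)%E [set z | C z.1 /\ D (dec z)].
  unshelve eexists (pushforward (mrestr (pi \x lam)%E mC1) (dec : T * R -> coin_space nat)).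
    exact: mdec.
  move=> D'; rewrite -[LHS]/((pi \x lam)%E ((dec @^-1` D') `&` [set z | C z.1])).
  by rewrite setIC.
have [m2 m2E] : exists m2 : {measure set (coin_space nat) -> \bar R},
    forall D, m2 D = mu [set w | C (X w) /\ D (Y w)].
  unshelve eexists (pushforward (mrestr mu (mX mC)) Y).
    exact: measurable_funPT.
  move=> D'; rewrite -[LHS]/(mu ((Y @^-1` D') `&` (X @^-1` C))).
  by rewrite setIC.
rewrite -m1E -m2E; move: D mD.
apply: (pi_system_unique sigma_prefix_sets).
- exact: prefix_sets_setI.
- right; exists [::]; by apply/seteqP; split.
- rewrite m1E (@le_lt_trans _ _ ((pi \x lam)%E setT)) //.
    apply: le_measure; rewrite ?inE //.
    by rewrite (_ : [set z | _] = [set z | C z.1]) //; apply/seteqP; split => z //= [].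
  by rewrite -setXTT product_measure1E // ltey_eq fin_numM // fin_num_measure.
by move=> _ [->|[y ->]]; rewrite ?measure0 // m1E m2E prefE.
Qed.

(** The next state is coded into bits by [iota], the bits are decoded from the uniform variable, and
    [rho] turns them back into a state; being defined on all bit sequences, it makes [phi] total. *)
Lemma randomization (X1 : {mfun Omega >-> T}) : standard_borel R T ->
  exists phi : T * R -> T, measurable_fun setT phi /\
    forall C B, measurable C -> measurable B ->
      (pi \x lam)%E [set z | C z.1 /\ B (phi z)] =
      mu [set w | C (X w) /\ B (X1 w)].
Proof.
move=> /standard_borel_retract[iota [rho [miota mrho rhoK]]].
have mY : measurable_fun setT (iota \o X1).
  by apply: measurableT_comp => //; exact: measurable_funPT.
pose Y : {mfun Omega >-> coin_space nat} :=
  HB.pack (iota \o X1) (isMeasurableFun.Build _ _ _ _ _ mY).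
have [dec [mdec decE]] := decode_law Y.
exists (rho \o dec); split; first exact: measurableT_comp.
move=> C B mC mB; have mB' : measurable (rho @^-1` B).
  by rewrite -[_ @^-1` _]setTI; exact: mrho.
have := decE C _ mC mB'; rewrite /= => ->; congr (mu _).
by apply/seteqP; split => w /=; rewrite rhoK.
Qed.

End randomization_exists.

Lemma measure_setY_trans (R : realType) d (T : measurableType d)
    (mu : probability T R) (A B C : set T) :
  measurable A -> measurable B -> measurable C ->
  mu (A `+` B) = 0%E -> mu (B `+` C) = 0%E -> mu (A `+` C) = 0%E.
Proof.
move=> mA mB mC AB BC.
have mY (X Y : set T) : measurable X -> measurable Y -> measurable (X `+` Y).
  by move=> mX mY; apply: measurableU; exact: measurableD.
apply: (subset_measure0 (B := (A `+` B) `|` (B `+` C))).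
- exact: mY.
- by apply: measurableU; exact: mY.
- move=> x; have [Bx|nBx] := pselect (B x).
    by move=> [[Ax nCx]|[Cx nAx]]; [right; left|left; right].
  by move=> [[Ax nCx]|[Cx nAx]]; [left; left|right; right].
- by apply: null_set_setU => //; exact: mY.
Qed.

(** * The zero-one law for the shift of the rows *)

Section zero_one.
Context (R : realType).
Variable kappa : probability (coin_space (nat * nat)) R.
Hypothesis fair_kappa : fair kappa.

Let W : measurableType _ := coin_space (nat * nat).

Definition row_shift n : (nat * nat -> bool) -> (nat * nat -> bool) :=
  reindex (fun p : nat * nat => (p.1 + n, p.2)%N).

Lemma row_shift_inj n : injective (fun p : nat * nat => (p.1 + n, p.2)%N).
Proof. by move=> [i j] [i' j'] /= [/addIn -> ->]. Qed.

Let mshift n (A : set W) : measurable A -> measurable (row_shift n @^-1` A : set W).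
Proof. by move=> mA; rewrite -[X in measurable X]setTI; exact: measurable_reindex. Qed.

(** The shifted event reads only rows from [n] on, the cylinder only rows before [n]; they are
    independent. *)
Lemma fair_cylinder_shift n (s : seq ((nat * nat) * bool)) (E : set W) :
  uniq (unzip1 s) -> all (fun p => p.1 < n)%N (unzip1 s) -> measurable E ->
  kappa (row_shift n @^-1` E `&` cylinder s) = (((2^-1) ^+ size s)%:E * kappa E)%E.
Proof.
move=> us sn mE; have ms : measurable (cylinder s : set W) := measurable_cylinder s.
have [m' m'E] : exists m' : {measure set W -> \bar R},
    forall B, m' B = kappa (row_shift n @^-1` B `&` cylinder s).
  by unshelve eexists (pushforward (mrestr kappa ms) (row_shift n : W -> W));
    [exact: measurable_reindex|].
have r0 : 0 <= (2^-1 : R) ^+ size s by rewrite exprn_ge0 // invr_ge0.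
rewrite -m'E -[RHS]/(mscale (NngNum r0) kappa E).
apply: coin_measure_unique => // [|s' us'].
  rewrite m'E (@le_lt_trans _ _ (kappa setT)) //.
    apply: le_measure; rewrite ?inE //; apply: measurableI => //.
    exact: mshift.
  by rewrite probability_setT ltry.
rewrite -[RHS]/(((2^-1) ^+ size s)%:E * kappa (cylinder s'))%E.
rewrite m'E /row_shift fair_kappa // reindex_cylinder.
rewrite (_ : _ `&` _ =
    cylinder ([seq ((p.1.1 + n, p.1.2)%N, p.2) | p <- s'] ++ s)).
  rewrite fair_kappa; first by rewrite size_cat size_map -EFinM -exprD addnC.
  rewrite /unzip1 map_cat -/(unzip1 _) -/(unzip1 _).
  rewrite (unzip1_reindex (fun p : nat * nat => (p.1 + n, p.2)%N)) cat_uniq.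
  rewrite (map_inj_uniq (@row_shift_inj n)) us us' /= andbT.
  apply/hasPn => q /(allP sn) qn; apply/mapP => -[j _ qj].
  by move: qn; rewrite qj /= ltnNge leq_addl.
apply/seteqP; split => b; rewrite /cylinder /= all_cat; last by move/andP.
by move=> [? ?]; apply/andP.
Qed.

(** Up to null sets [E] equals its shift by [n] rows for every [n], and an [n] beyond the rows of a
    given cylinder makes it independent of that cylinder. Hence [E] is independent of every event,
    in particular of itself, and its measure solves [r * r = r]. *)
Lemma shift_zero_one (E : set W) : measurable E ->
  kappa (E `+` row_shift 1 @^-1` E) = 0%E -> kappa E = 0%E \/ kappa E = 1%E.
Proof.
move=> mE inv1.
have mp1 (B : set W) : measurable B -> kappa (row_shift 1 @^-1` B) = kappa B.
  by move=> mB; apply: fair_reindex => //; exact: row_shift_inj.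
have inv n : kappa (E `+` row_shift n @^-1` E) = 0%E.
  elim: n => [|n IH].
    rewrite (_ : _ @^-1` E = E) ?setYK ?measure0 //.
    apply/seteqP; split => b; rewrite /row_shift /reindex /preimage /= (_ : b \o _ = b) //;
    by apply/funext => -[i j] /=; rewrite addn0.
  have mEn := mshift n mE; have mE1 := mshift 1 mE.
  have shS : row_shift n.+1 @^-1` E = row_shift 1 @^-1` (row_shift n @^-1` E).
    apply/seteqP; split => b; rewrite /row_shift /reindex /preimage /=;
    by congr E; apply/funext => -[i j] /=; rewrite addn1 addnS.
  apply: (measure_setY_trans mE mE1 (mshift n.+1 mE) inv1); rewrite shS.
  rewrite -[RHS]IH -[RHS]mp1; last first.
    by apply: measurableU; apply: measurableD => //; exact: mshift.
  by congr (kappa _); apply/seteqP; split => b.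
have mEn n := mshift n mE.
have indep (B : set W) : measurable B -> kappa (E `&` B) = (kappa E * kappa B)%E.
  have [m1 m1E] : exists m1 : {measure set W -> \bar R},
      forall B, m1 B = kappa (E `&` B).
    by exists (mrestr kappa mE) => B'; rewrite setIC.
  have [m2 m2E] : exists m2 : {measure set W -> \bar R},
      forall B, m2 B = (kappa E * kappa B)%E.
    exists (mscale (NngNum (fine_ge0 (measure_ge0 kappa E))) kappa) => B'.
    rewrite -[LHS]/((fine (kappa E))%:E * kappa B')%E fineK //.
    exact: fin_num_measure.
  move=> mB; rewrite -m1E -m2E; move: B mB.
  apply: coin_measure_unique => [|s us].
    rewrite m1E setIT (@le_lt_trans _ _ 1%E) ?ltry //.
    exact: probability_le1.
  rewrite m1E m2E fair_kappa // muleC.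
  pose n := foldr maxn 0%N [seq p.1.+1 | p <- unzip1 s].
  have sn : all (fun p => p.1 < n)%N (unzip1 s).
    apply/allP => q; rewrite /n; elim: (unzip1 s) => // j r IH /=.
    by rewrite inE leq_max => /orP[/eqP -> |/IH ->]; rewrite ?leqnn ?orbT.
  rewrite -(fair_cylinder_shift us sn mE).
  have ms : measurable (cylinder s : set W) := measurable_cylinder s.
  have [en ne] := (measure_setYP kappa mE (mEn n)).1 (inv n).
  have mI1 := measurableI _ _ (mEn n) ms; have mI2 := measurableI _ _ mE ms.
  have mD1 := measurableD mE (mEn n); have mD2 := measurableD (mEn n) mE.
  apply/eqP; rewrite eq_le; apply/andP; split.
    rewrite -[leRHS]adde0 -en.
    apply: le_trans _ (measureU2 kappa mI1 mD1).
    apply: le_measure; rewrite ?inE //; first exact: measurableU mI1 mD1.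
    move=> b [Eb sb]; have [?|?] := pselect ((row_shift n @^-1` E) b); first by left.
    by right.
  rewrite -[leRHS]adde0 -ne; apply: le_trans _ (measureU2 kappa mI2 mD2).
  apply: le_measure; rewrite ?inE //; first exact: measurableU mI2 mD2.
  by move=> b [Eb sb]; have [?|?] := pselect (E b); [left|right].
have := indep E mE; rewrite setIid.
have Efin : kappa E \is a fin_num by exact: fin_num_measure.
rewrite -(fineK Efin) -EFinM => -[]; set r := fine _ => rr.
have [->|r0] := eqVneq r 0; first by left.
right; congr EFin; apply: (mulfI r0); by rewrite mulr1.
Qed.

End zero_one.

(** * The Markov shift on states and coin arrays *)

Section construction.
Context (R : realType) (d0 : measure_display) (T : measurableType d0).

Let W : measurableType _ := coin_space (nat * nat).

Definition first_row : (nat * nat -> bool) -> (nat -> bool) :=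
  reindex (fun j : nat => (0%N, j)).

(** [bump k] skips the value [k], so reading through it omits row [k] and renumbers the later
    rows. *)
Definition delete_row k : (nat * nat -> bool) -> (nat * nat -> bool) :=
  reindex (fun p : nat * nat => (bump k p.1, p.2)).

(* The driving noise is an array of fair coins; its first row, read in base 2,
   is the uniform variable feeding [phi]. *)
Definition markov_shift (phi : T * R -> T) (k : nat) (z : T * W) : T * W :=
  if k is l.+1 then (z.1, delete_row l z.2)
  else (phi (z.1, expansion 2 (first_row z.2)), row_shift 1 z.2).

Lemma delete_row_inj k : injective (fun p : nat * nat => (bump k p.1, p.2)).
Proof. by move=> [i j] [i' j'] /= [/(can_inj (bumpK k)) -> ->]. Qed.

Lemma first_row_inj : injective (fun j : nat => (0%N, j)).
Proof. by move=> i j []. Qed.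

(** The coface identity of the simplex category; it yields the relations among deletions of rows. *)
Lemma bump_bump k l i : (k <= l)%N -> bump k (bump l i) = bump l.+1 (bump k i).
Proof.
rewrite /bump => kl; case: (leqP l i) => li /=.
  rewrite add1n !(leq_trans kl) //; last exact: leqW.
  by rewrite !add1n ltnS li add1n.
rewrite add0n; case: (leqP k i) => ki; rewrite ?add1n ?add0n.
  by rewrite ltnS leqNgt li.
by rewrite leqNgt (leq_trans li).
Qed.

(** For [k = 0], dropping row 0 lowers the numbers of the other rows by one, and the row deleted
    first on the right has positive number, so the row feeding [phi] is left intact. The other cases
    are [bump_bump]. *)
Lemma markov_shift_rel phi k l z : (k < l)%N ->
  markov_shift phi l (markov_shift phi k z) = markov_shift phi k (markov_shift phi l.+1 z).
Proof.
case: l => // l; case: k => [_|k]; last rewrite ltnS => kl; rewrite /=.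
  congr pair; apply/funext => -[i j].
  rewrite /delete_row /row_shift /reindex /= !addn1; congr (z.2 (_, _)).
  by rewrite /bump ltnS addnS.
congr pair; apply/funext => -[i j]; rewrite /delete_row /reindex /=.
by rewrite bump_bump // ltnW.
Qed.

Lemma measurable_markov_shift phi k : measurable_fun setT phi ->
  measurable_fun setT (markov_shift phi k).
Proof.
move=> mphi; case: k => [|k] /=; last first.
  apply: measurable_fun_pair => //.
  by apply: measurableT_comp measurable_snd; exact: measurable_reindex.
apply: measurable_fun_pair.
  apply: measurableT_comp => //; apply: measurable_fun_pair => //.
  apply: (@measurableT_comp _ _ _ _ _ _ (expansion 2 : coin_space nat -> R)).
    exact: measurable_expansion (lexx 2).
  by apply: measurableT_comp measurable_snd; exact: measurable_reindex.
by apply: measurableT_comp measurable_snd; exact: measurable_reindex.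
Qed.

Context (d : measure_display) (Omega : measurableType d).
Variables (mu : probability Omega R) (xi : nat -> {RV mu >-> T}).
Variable lam : probability R R.
Hypothesis lamE : forall A, measurable A ->
  lam A = lebesgue_measure (A `&` `[0, 1[%classic).
Variable kappa : probability W R.
Hypothesis fair_kappa : fair kappa.

Let pi : probability T R := distribution mu (xi 0%N).

Variable m : probability (T * W)%type R.
Hypothesis mE : forall A, m A = (pi \x kappa)%E A.

Variable phi : T * R -> T.
Hypothesis mphi : measurable_fun setT phi.
Hypothesis phiE : forall C B, measurable C -> measurable B ->
  (pi \x lam)%E [set z | C z.1 /\ B (phi z)] =
  mu [set w | C (xi 0%N w) /\ B (xi 1%N w)].
Hypothesis st : stationary xi.

(** For a fixed state the first row gives a uniform variable independent of the remaining rows. With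
    [C] the whole space this shows that the step preserves the measure; with [B] the whole space it
    gives the law of the first two states. *)
Lemma markov_shift0_law (C A : set T) (B : set W) :
  measurable C -> measurable A -> measurable B ->
  m ((C `*` setT) `&` markov_shift phi 0 @^-1` (A `*` B)) =
  (mu [set w | C (xi 0%N w) /\ A (xi 1%N w)] * kappa B)%E.
Proof.
move=> mC mA mB; rewrite -phiE // mE /product_measure1.
have mS : measurable [set z : T * R | C z.1 /\ A (phi z)].
  apply: (@measurableI _ _ [set z : T * R | C z.1]).
    by rewrite -[X in measurable X]setTI; exact: measurable_fst.
  by rewrite -[X in measurable X]setTI; exact: mphi.
have [kappa0 [fair0 _]] := fair_exists lamE nat.
have sec x : kappa (xsection ((C `*` setT) `&` markov_shift phi 0 @^-1` (A `*` B)) x) =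
    (lam (xsection [set z : T * R | C z.1 /\ A (phi z)] x) * kappa B)%E.
  have mSx := measurable_xsection x mS.
  rewrite -(fair_uniform lamE fair0 mSx).
  rewrite -(fair_split first_row_inj (@row_shift_inj 1) _ fair_kappa fair0 fair_kappa) //.
  - congr (kappa _); apply/seteqP; split => b; rewrite /xsection /preimage /= !inE /=.
      by move=> [[Cx _] [Ab Bb]].
    by move=> [[Cx Ab] Bb].
  - by move=> i [i' j']; rewrite xpair_eqE addn1.
  - rewrite -[X in measurable X]setTI.
    exact: (measurable_expansion (lexx 2) measurableT mSx).
under eq_integral do rewrite /= sec.
rewrite ge0_integralZr //.
exact: measurable_fun_xsection.
Qed.

(** Tested on rectangles. For [k = 0] stationarity enters: the new state has the law of [xi 1],
    which is that of [xi 0]. Deleting a row is an injective reindexing of fair coins. *)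
Lemma markov_shift_preserving k : measure_preserving m (markov_shift phi k).
Proof.
have pisum A : measurable A -> mu [set w | A (xi 1%N w)] = pi A.
  move=> mA; have := st (n := 1) isT (A := [set x | A (x 0%N)]); rewrite /= addn0 => <-//.
  rewrite -[X in cylinder_sigma X]setTI.
  by apply: (@measurable_coord_proj _ _ T [set: nat] 0%N).
have [m' m'E] : exists m' : {measure set (T * W) -> \bar R},
    forall A, m' A = m (markov_shift phi k @^-1` A).
  by unshelve eexists (pushforward m (markov_shift phi k));
    [exact: measurable_markov_shift|].
move=> A mA; rewrite -m'E [RHS]mE; apply/esym; move: A mA.
apply: product_measure_unique => A B mA mB; rewrite m'E.
case: k m'E => [|k] _.
  have := markov_shift0_law measurableT mA mB.
  rewrite setXTT setTI => ->; congr (_ * _)%E.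
  apply: etrans (pisum _ mA); congr (mu _).
  by apply/seteqP; split => w // [].
rewrite (_ : _ @^-1` _ = A `*` (delete_row k @^-1` B)); last first.
  by apply/seteqP; split => z.
have mBk : measurable (delete_row k @^-1` B : set W).
  by rewrite -[X in measurable X]setTI; exact: measurable_reindex.
rewrite mE product_measure1E //; congr (_ * _)%E.
by apply: fair_reindex => //; exact: delete_row_inj.
Qed.

Lemma markov_shift1_invariant A : measurable A ->
  m (A `+` markov_shift phi 1 @^-1` A) = 0%E ->
  exists2 C : set T, measurable C & m (A `+` fst @^-1` C) = 0%E.
Proof.
move=> mA.
have mA1 : measurable (markov_shift phi 1 @^-1` A).
  by rewrite -[X in measurable X]setTI; exact: measurable_markov_shift.
have mY (X Y : set (T * W)) : measurable X -> measurable Y -> measurable (X `+` Y).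
  by move=> mX mY; apply: measurableU; exact: measurableD.
have null_sections X : measurable X -> m X = 0%E <->
    {ae pi, forall x, kappa (xsection X x) = 0%E}.
  move=> mX; have mf := measurable_fun_xsection kappa mX.
  rewrite mE /product_measure1; split => [I0|ae0].
    have [|ae0 _] := ae_eq_integral_abs pi measurableT (f := kappa \o xsection X).
      by [].
    have : ae_eq pi setT (kappa \o xsection X) (cst 0%E).
      apply: ae0; rewrite -[RHS]I0; apply: eq_integral => x _.
      by rewrite gee0_abs.
    by apply: filterS => x /(_ Logic.I).
  rewrite -[RHS](integral0 pi setT); apply: ae_eq_integral => //.
  by apply: filterS ae0 => x + _.
move=> /null_sections ae0.
(* For almost all states the section of [A] has measure 0 or 1, so up to null sets this is the only
   candidate. *)
pose C := [set x | kappa (xsection A x) = 1%E].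
have mC : measurable C.
  have := measurable_fun_xsection kappa mA measurableT (emeasurable_set1 1%E).
  by rewrite setTI.
exists C => //; apply/null_sections.
  by apply: mY => //; rewrite -[X in measurable X]setTI; exact: measurable_fst.
apply: filterS (ae0 (mY _ _ mA mA1)) => x x0.
have mAx : measurable (xsection A x : set W) := measurable_xsection x mA.
have secE (B1 B2 : set (T * W)) : xsection (B1 `+` B2) x = xsection B1 x `+` xsection B2 x.
  by apply/seteqP; split => b; rewrite /xsection /setY /setD /= !inE.
have [E0|E1] : kappa (xsection A x) = 0%E \/ kappa (xsection A x) = 1%E.
  (* [markov_shift phi 1] keeps the state and deletes row 0, so on each section it acts as
     [row_shift 1]. *)
  apply: (shift_zero_one fair_kappa mAx); rewrite -[RHS]x0 secE; congr (kappa (_ `+` _)).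
  apply/seteqP; split => b; rewrite /xsection /preimage /= !inE /= /delete_row /row_shift;
  by congr (A (_, _)); apply/funext => -[i j]; rewrite /reindex /bump /= add1n addn1.
- rewrite (_ : xsection _ x = xsection A x) //.
  rewrite secE (_ : xsection (fst @^-1` C) x = set0) ?setY0 //.
  apply/seteqP; split => // b; rewrite /xsection /= inE /C /= E0 => /eqP.
  by rewrite eqe eq_sym oner_eq0.
rewrite secE (_ : xsection (fst @^-1` C) x = setT) ?setYT; last first.
  by apply/seteqP; split => // b _; rewrite /xsection /= inE.
rewrite (_ : _ `+` _ = ~` xsection A x) ?probability_setC ?E1 ?subee //.
by rewrite /setY setDT setTD set0U.
Qed.

End construction.

(** * Transport to the real line and conclusion *)

Lemma standard_borel_real (R : realType) : standard_borel R R.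
Proof.
exists R, id; split.
- exact: norm_hausdorff.
- exists (range (@ratr R)); last exact: dense_rat.
  exact: (card_le_trans (card_image_le _ _) (countableP _)).
- by exists id.
move=> A; rewrite image_id; split; last first.
  move: A; apply: smallest_sub; first exact: sigma_algebra_measurable.
  by move=> U oU; exact: open_measurable.
rewrite [measurable](RGenOpens.measurableE R); move: A.
apply: smallest_sub; first exact: smallest_sigma_algebra.
by move=> _ [x [y ->]]; apply: sub_sigma_algebra; exact: interval_open.
Qed.

(** The easy half of maximality, valid for every partial spreading: by localization the events of
    [X 0] are invariant at every point, and a null modification stays null because [eta k] preserves
    the measure. *)
Lemma completed_sigma_invariant (R : realType) d0 d (T : measurableType d0)
    (Z : measurableType d) (m : probability Z R) (X : nat -> {RV m >-> T})
    (eta : nat -> {mfun Z >-> Z}) k : (0 < k)%N ->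
  partial_spreading X eta ->
  completed_sigma m (X 0%N) `<=` almost_invariant m (eta k).
Proof.
move=> k0 [mp _ loc _] A [mA [C mC AC]]; split => //.
have pre B : measurable B -> measurable (eta k @^-1` B).
  by move=> mB; rewrite -[X in measurable X]setTI; exact: measurable_funPT.
have mXC : measurable (X 0%N @^-1` C).
  by rewrite -[X in measurable X]setTI; exact: measurable_funPT.
apply: (measure_setY_trans mA mXC (pre _ mA) AC).
rewrite -[RHS]AC -[RHS](mp k); last by apply: measurableU; exact: measurableD.
congr (m _); rewrite (_ : eta k @^-1` (A `+` X 0%N @^-1` C) =
  X 0%N @^-1` C `+` eta k @^-1` A) //.
rewrite setYC; apply/seteqP; split => z;
by have /= locz := loc k k0 z; rewrite /setY /setD /preimage /= -locz.
Qed.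

Section transport.
Context (R : realType) (d0 d1 d2 : measure_display).
Context (T : measurableType d0) (Z : measurableType d1) (Y : measurableType d2).
Variables (m : probability Z R) (X : nat -> {RV m >-> T}).
Variable eta : nat -> {mfun Z >-> Z}.

(** Conjugation: a point is decoded by [D], moved, and coded again. As [D] undoes [E] everywhere,
    all identities survive at every point. The hard half of maximality is asked for [eta 1] alone,
    since the intersection is contained in its first member. *)
Lemma spreading_transport (E : Z -> Y) (D : Y -> Z) :
  measurable_fun setT E -> measurable_fun setT D -> cancel E D ->
  partial_spreading X eta ->
  (forall A, almost_invariant m (eta 1%N) A -> completed_sigma m (X 0%N) A) ->
  exists (m' : probability Y R) (X' : nat -> {RV m' >-> T})
      (eta' : nat -> {mfun Y >-> Y}),
    [/\ same_law X' X, partial_spreading X' eta' &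
        sigma_rv X' [set 0%N] =
          \bigcap_(k in [set k | (1 <= k)%N]) almost_invariant m' (eta' k)].
Proof.
move=> mE mD EK sp max.
have [mp rel loc it] := sp.
pose E' : {mfun Z >-> Y} := HB.pack E (isMeasurableFun.Build _ _ _ _ _ mE).
pose m' : probability Y R := distribution m E'.
have m'E A : m' A = m (E @^-1` A) by [].
have mX' n : measurable_fun setT (X n \o D) by exact: measurableT_comp.
pose X' n : {RV m' >-> T} := HB.pack (X n \o D) (isMeasurableFun.Build _ _ _ _ _ (mX' n)).
have meta' k : measurable_fun setT (E \o (eta k \o D)).
  by apply: measurableT_comp => //; exact: measurableT_comp.
pose eta' k : {mfun Y >-> Y} :=
  HB.pack (E \o (eta k \o D)) (isMeasurableFun.Build _ _ _ _ _ (meta' k)).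
have eta'E k y : eta' k y = E (eta k (D y)) by [].
have spr : partial_spreading X' eta'.
  split.
  - move=> k A mA; rewrite !m'E -[RHS](mp k); last first.
      by rewrite -[X in measurable X]setTI; exact: (measurable_funPT E').
    by congr (m _); apply/seteqP; split => z; rewrite /preimage /= EK.
  - by move=> k l kl y; rewrite /= !EK; congr E; exact: rel.
  - by move=> k k0 y; rewrite /= EK; exact: loc.
  - move=> n y; rewrite /= it /=; congr (X 0%N _).
    by elim: n => //= n <-; rewrite EK.
exists m', X', eta'; split => //.
  by move=> A _; congr (m _); apply/seteqP; split => z; rewrite /preimage /= EK.
rewrite sigma_rv1E; apply/seteqP; split.
  by move=> A AX k /= k0; exact: (completed_sigma_invariant k0 spr).
move=> A /(_ 1%N isT) [mA A0]; split => //.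
have mEA : measurable (E @^-1` A).
  by rewrite -[X in measurable X]setTI; exact: (measurable_funPT E').
have [|_ [C mC EAC]] := max (E @^-1` A).
  split => //; rewrite -[RHS]A0 m'E; congr (m _).
  by apply/seteqP; split => z; rewrite /setY /setD /preimage /= EK.
exists C => //; rewrite m'E -[RHS]EAC; congr (m _).
by apply/seteqP; split => z; rewrite /setY /setD /preimage /= EK.
Qed.

End transport.

(** The bits of the state and those of the array are merged into one sequence by enumerating the sum
    type [nat + nat * nat], then read as one number; its digits return both families of bits. *)
Lemma real_coding (R : realType) d (T : measurableType d) : standard_borel R T ->
  exists (E : T * coin_space (nat * nat) -> R) (D : R -> T * coin_space (nat * nat)),
    [/\ measurable_fun setT E, measurable_fun setT D & cancel E D].
Proof.
move=> /standard_borel_retract[iota [rho [miota mrho iotaK]]].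
pose bits (z : T * coin_space (nat * nat)) (n : nat) : bool :=
  match unpickle n : option (nat + nat * nat) with
  | Some (inl i) => iota z.1 i
  | Some (inr j) => z.2 j
  | None => false
  end.
pose D (r : R) : T * coin_space (nat * nat) :=
  (rho (fun i => digit 3 r (pickle (inl i : nat + nat * nat))),
   fun j => digit 3 r (pickle (inr j : nat + nat * nat))).
have le23 : (2 : R) <= 3 by lra.
have lt23 : (2 : R) < 3 by lra.
exists (expansion 3 \o bits), D; split.
- apply: (@measurableT_comp _ _ _ _ _ _ (expansion 3 : coin_space nat -> R)).
    exact: measurable_expansion.
  apply: measurable_coord_fun => n _; rewrite /bits.
  case: (unpickle n : option (nat + nat * nat)) => [[i|j]|] //.
    apply: (@measurableT_comp _ _ _ _ _ _ (fun x => iota x i)) => //.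
    exact: (measurableT_comp (@measurable_coord_proj _ _ bool [set: nat] i Logic.I) miota).
  exact: (measurableT_comp
    (@measurable_coord_proj _ _ bool [set: nat * nat] j Logic.I) measurable_snd).
- apply: measurable_fun_pair.
    apply: (measurableT_comp mrho); apply: measurable_coord_fun => i _.
    exact: measurable_digit.
  by apply: measurable_coord_fun => j _; exact: measurable_digit.
move=> [x b]; rewrite /D /= !expansion_digitK //; congr pair.
  rewrite -[RHS]iotaK; congr rho; apply/funext => i.
  by rewrite /bits pickleK.
by rewrite /bits; apply: (@funext _ _ _ b) => j; rewrite pickleK.
Qed.

Lemma spreading_model (R : realType) d0 d (T : measurableType d0)
    (Omega : measurableType d) (mu : probability Omega R)
    (xi : nat -> {RV mu >-> T}) : standard_borel R T -> stationary xi ->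
  exists (m : probability R R) (X : nat -> {RV m >-> T})
      (eta : nat -> {mfun R >-> R}),
    [/\ partial_spreading X eta,
        sigma_rv X [set 0%N] =
          \bigcap_(k in [set k | (1 <= k)%N]) almost_invariant m (eta k) &
        forall C B, measurable C -> measurable B ->
          m [set w | C (X 0%N w) /\ B (X 1%N w)] =
          mu [set w | C (xi 0%N w) /\ B (xi 1%N w)]].
Proof.
move=> sbT st; have [E [D [mE mD EK]]] := real_coding sbT.
have [lam lamE] := uniform01 R.
have [phi [mphi phiE]] := randomization mu (xi 0%N) lamE (xi 1%N) sbT.
have [kappa0 [fair0 kappa0E]] := fair_exists lamE (nat * nat)%type.
have [|kappa kappaE] := probability_of_measure (m := kappa0).
  by rewrite kappa0E probability_setT.
have fair_kappa : fair kappa by move=> s us; rewrite kappaE fair0.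
pose pi : probability T R := distribution mu (xi 0%N).
have [|m mE'] := probability_of_measure (m := (pi \x kappa)%E).
  have := product_measure1E pi kappa measurableT measurableT.
  rewrite setXTT => pikappaT; apply: etrans pikappaT _; rewrite -[RHS]mule1.
  by congr (_ * _)%E; exact: probability_setT.
have ms k : measurable_fun setT (markov_shift phi k).
  exact: measurable_markov_shift.
pose eta k : {mfun _ >-> _} :=
  HB.pack (markov_shift phi k) (isMeasurableFun.Build _ _ _ _ _ (ms k)).
have mX n : measurable_fun setT (fst \o iter n (markov_shift phi 0) :
    T * coin_space (nat * nat) -> T).
  apply: measurableT_comp => //; elim: n => [|n IH]; first exact: measurable_id.
  exact: (measurableT_comp (ms 0%N) IH).
pose X n : {RV m >-> T} := HB.pack (fst \o iter n (markov_shift phi 0))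
  (isMeasurableFun.Build _ _ _ _ _ (mX n)).
have sp : partial_spreading X eta.
  split => //.
  - exact: (markov_shift_preserving lamE fair_kappa mE' mphi phiE st).
  - by move=> k l kl z; exact: markov_shift_rel.
  - by case.
have max A : almost_invariant m (eta 1%N) A -> completed_sigma m (X 0%N) A.
  move=> [mA A0]; split => //.
  exact: (markov_shift1_invariant fair_kappa mE' mphi mA A0).
have [m' [X' [eta' [law sp' max']]]] := spreading_transport mE mD EK sp max.
exists m', X', eta'; split => // C B mC mB.
have mCB : cylinder_sigma [set x : nat -> T | C (x 0%N) /\ B (x 1%N)].
  rewrite -[X in cylinder_sigma X]/((fun x : nat -> T => x 0%N) @^-1` C `&`
    (fun x : nat -> T => x 1%N) @^-1` B).
  apply: (@measurableI _ (coord_space T [set: nat])).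
    rewrite -[X in measurable X]setTI.
    exact: (@measurable_coord_proj _ _ T [set: nat] 0%N Logic.I measurableT C).
  rewrite -[X in measurable X]setTI.
  exact: (@measurable_coord_proj _ _ T [set: nat] 1%N Logic.I measurableT B).
rewrite (law _ mCB) -[RHS]mule1 -(@probability_setT _ _ _ kappa).
rewrite -(markov_shift0_law lamE fair_kappa mE' mphi phiE mC mB measurableT).
by congr (m _); apply/seteqP; split => z /=; [move=> []|move=> [[? _] []]].
Qed.

Theorem theorem1p0p1 (R : realType) (d0 d : measure_display)
    (Omega0 : measurableType d0) (Omega : measurableType d)
    (mu : probability Omega R) (xi : nat -> {RV mu >-> Omega0})
    (hOmega0 : standard_borel R Omega0) (hOmega : standard_borel R Omega) :
  maximal_partially_spreadable xi <-> stationary xi /\ markov_sequence xi.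
Proof.
split.
  move=> [d' [S [nu [xi' [eta [_ law sp max]]]]]]; split.
    exact: same_law_stationary law (spreading_stationary sp).
  apply: markov_law_sequence.
  exact: same_law_markov law (spreading_markov_law sp max).
move=> [st /markov_sequence_law ml].
have [m [X [eta [sp max pair]]]] := spreading_model hOmega0 st.
exists _, R, m, X, eta; split => //; first exact: standard_borel_real.
(* The Markov property of the model is not verified on the construction: the argument of the first
   implication supplies it from maximality. *)
apply: (markov_law_unique st (spreading_stationary sp) ml (spreading_markov_law sp max)).
by move=> C B mC mB; rewrite pair.
Qed.
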